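(* Let $G$ be the one-relator group $$G=\langle a,b\ |\ a^{b^2}=a\,a^{3b}\rangle,$$ where $a^{b^2}=b^{-2}ab^2$ and $a^{3b}=b^{-1}a^3b$. Then the lower central series of $G$ has length $\omega^2$.
   Context: Here $\omega$ is the first infinite ordinal and $\omega^2=\omega\cdot\omega$. Conventions: for elements $x,y$ of a group, $x^y=y^{-1}xy$, $[x,y]=x^{-1}y^{-1}xy$, and $x^{3y}=(x^3)^y=y^{-1}x^3y$. For a group $G$, the transfinite lower central series is defined inductively by $\gamma_1(G)=G$, $\gamma_{\alpha+1}(G)=[\gamma_\alpha(G),G]$ for every ordinal $\alpha\ge 1$, and $\gamma_\tau(G)=\bigcap_{\alpha<\tau}\gamma_\alpha(G)$ for a limit ordinal $\tau$, the indices $\alpha$ being ordinals $\geq 1$. The length of the lower central series of $G$ is the smallest ordinal $\alpha$ such that $\gamma_\alpha(G)=\gamma_{\alpha+1}(G)$. *)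

(* Defs.v *)
From HB Require Import structures.
From mathcomp Require Import all_boot.
From mathcomp Require Import boolp classical_sets.
Set Implicit Arguments.
Unset Strict Implicit.
Unset Printing Implicit Defensive.
Local Open Scope group_scope.
Local Open Scope classical_set_scope.
Local Open Scope quotient_scope.

(* Group words over X: (x, false) is the letter x and (x, true) its formal
   inverse. Words are not reduced; they carry multiplication, unit and formal
   inversion, so that the group notations apply to them, but the group laws
   only hold in the quotients [presented] below. *)
Definition word (X : choiceType) : Type := seq (X * bool).
HB.instance Definition _ (X : choiceType) := Choice.on (word X).
HB.instance Definition _ (X : choiceType) :=
  hasMul.Build (word X) (fun u v : seq (X * bool) => u ++ v).
HB.instance Definition _ (X : choiceType) :=
  hasOne.Build (word X) (Nil (X * bool)).
HB.instance Definition _ (X : choiceType) :=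
  hasInv.Build (word X)
    (fun u : seq (X * bool) => rev [seq (l.1, ~~ l.2) | l <- u]).

Definition letter (X : choiceType) (x : X) : word X := [:: (x, false)].

(* Two words are congruent modulo the relations R when they are equal in the
   group with generators X and defining relations l = r for R l r. *)
Inductive word_cong (X : choiceType) (R : word X -> word X -> Prop) :
    word X -> word X -> Prop :=
| wc_rel (u v l r : word X) : R l r -> word_cong R (u * l * v) (u * r * v)
| wc_cancel (u v : word X) (x : X) (e : bool) :
    word_cong R (u * ([:: (x, e); (x, ~~ e)] : word X) * v) (u * v)
| wc_refl (u : word X) : word_cong R u u
| wc_sym (u v : word X) : word_cong R u v -> word_cong R v u
| wc_trans (u v w : word X) :
    word_cong R u v -> word_cong R v w -> word_cong R u w.

Section Presentation.
Variables (X : choiceType) (R : word X -> word X -> Prop).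
Implicit Types u v w : word X.

Let wmulA u v w : u * (v * w) = u * v * w. Proof. exact: catA. Qed.
Let wmul1 u : 1 * u = u. Proof. by []. Qed.
Let wmulr1 u : u * 1 = u. Proof. exact: cats0. Qed.

Lemma word_cong_mul u u' v v' :
  word_cong R u u' -> word_cong R v v' -> word_cong R (u * v) (u' * v').
Proof.
move=> Ru Rv; apply: (@wc_trans _ _ _ (u' * v)).
  elim: Ru => {u u'}.
  - by move=> p q l r Rlr; rewrite -!(wmulA _ _ v); apply: wc_rel.
  - by move=> p q x e; rewrite -!(wmulA _ _ v) -!(wmulA p) wmulA; exact: wc_cancel.
  - by move=> u; apply: wc_refl.
  - by move=> u w _; apply: wc_sym.
  - by move=> u w z _ Ruw _; apply: wc_trans.
elim: Rv => {v v'}.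
- by move=> p q l r Rlr; rewrite !wmulA; apply: wc_rel.
- by move=> p q x e; rewrite !wmulA; apply: wc_cancel.
- by move=> v; apply: wc_refl.
- by move=> v w _; apply: wc_sym.
- by move=> v w z _ Rvw _; apply: wc_trans.
Qed.

Lemma word_cong_mulV u : word_cong R (u * u^-1) 1.
Proof.
move: u; apply: last_ind => [|u [x e] IHu]; first exact: wc_refl.
apply: wc_trans IHu.
have -> : (rcons u (x, e) : word X) * (rcons u (x, e) : word X)^-1 =
          (u : word X) * ([:: (x, e); (x, ~~ e)] : word X) * (u : word X)^-1.
  by rewrite /mul /inv /= map_rcons rev_rcons -!cats1 -!catA.
exact: wc_cancel.
Qed.

Let winvK u : u^-1^-1 = u.
Proof.
rewrite /inv /= map_rev revK -map_comp map_id_in // => -[x e] _ /=.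
by rewrite negbK.
Qed.

Let winvM u v : (u * v)^-1 = v^-1 * u^-1.
Proof. by rewrite /inv /mul /= map_cat rev_cat. Qed.

Lemma word_cong_mulVl u : word_cong R (u^-1 * u) 1.
Proof. by rewrite -{2}[u]winvK; apply: word_cong_mulV. Qed.

Lemma word_cong_inv u v : word_cong R u v -> word_cong R u^-1 v^-1.
Proof.
move=> Ruv; apply: (@wc_trans _ _ _ (u^-1 * (v * v^-1))).
  rewrite -{1}[u^-1]wmulr1; apply: word_cong_mul; first exact: wc_refl.
  exact/wc_sym/word_cong_mulV.
rewrite wmulA -[X in word_cong R _ X]wmul1.
apply: word_cong_mul; last exact: wc_refl.
apply: wc_trans (word_cong_mulVl u).
by apply: word_cong_mul; [apply: wc_refl|apply: wc_sym].
Qed.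

Definition word_congb : rel (word X) := fun u v => `[< word_cong R u v >].

Lemma word_congb_equiv : equiv_class_of word_congb.
Proof.
split=> [u|u v|v u w]; first by apply/asboolP/wc_refl.
  by apply/asboolP/asboolP; apply: wc_sym.
by move=> /asboolP Ruv /asboolP Rvw; apply/asboolP/(wc_trans Ruv).
Qed.

Canonical word_cong_rel := EquivRelPack word_congb_equiv.

Definition presented : Type := {eq_quot word_cong_rel}.
HB.instance Definition _ := Choice.on presented.

Definition pres_class (u : word X) : presented := \pi_{eq_quot word_cong_rel} u.

Lemma pres_classP u v : pres_class u = pres_class v <-> word_cong R u v.
Proof.
split=> [/eqmodP /asboolP //|Ruv].
by apply/eqmodP/asboolP.
Qed.

Definition pres_repr (x : presented) : word X :=
  repr (x : {eq_quot word_cong_rel}).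

Lemma pres_reprK x : pres_class (pres_repr x) = x.
Proof. exact: reprK. Qed.

Definition pres_mul (x y : presented) : presented :=
  pres_class (pres_repr x * pres_repr y).
Definition pres_inv (x : presented) : presented :=
  pres_class (pres_repr x)^-1.

Lemma pres_classM u v :
  pres_class (u * v) = pres_mul (pres_class u) (pres_class v).
Proof.
by apply/pres_classP/word_cong_mul; apply/pres_classP; rewrite pres_reprK.
Qed.

Lemma pres_classV u : pres_class u^-1 = pres_inv (pres_class u).
Proof. by apply/pres_classP/word_cong_inv/pres_classP; rewrite pres_reprK. Qed.

Fact pres_mulA : associative pres_mul.
Proof.
move=> x y z; rewrite -[x]pres_reprK -[y]pres_reprK -[z]pres_reprK.
by rewrite -!pres_classM wmulA.
Qed.
Fact pres_mul1 : left_id (pres_class 1) pres_mul.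
Proof. by move=> x; rewrite -[x]pres_reprK -pres_classM. Qed.
Fact pres_mulr1 : right_id (pres_class 1) pres_mul.
Proof. by move=> x; rewrite -[x]pres_reprK -pres_classM wmulr1. Qed.
Fact pres_mulV : left_inverse (pres_class 1) pres_inv pres_mul.
Proof.
move=> x; rewrite -[x]pres_reprK -pres_classV -pres_classM.
exact/pres_classP/word_cong_mulVl.
Qed.
Fact pres_mulVr : right_inverse (pres_class 1) pres_inv pres_mul.
Proof.
move=> x; rewrite -[x]pres_reprK -pres_classV -pres_classM.
exact/pres_classP/word_cong_mulV.
Qed.

HB.instance Definition _ := isGroup.Build presented
  pres_mulA pres_mul1 pres_mulr1 pres_mulV pres_mulVr.

End Presentation.

Definition subgroup_set (G : groupType) (H : set G) : Prop :=
  H 1 /\ forall x y, H x -> H y -> H (x / y).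

Definition comm_subgroup (G : groupType) (H K : set G) : set G :=
  smallest (@subgroup_set G) [set [~ x, y] | x in H & y in K].

(* Set-theoretic ordinals over a universe: [osup f] stands for the least
   ordinal strictly above all the f i, so that every ordinal strictly below
   [osup f] is at most some f i. Each ordinal has many representatives;
   [oeq] is equality of ordinals. *)
Inductive Ord : Type := osup (I : Type) (f : I -> Ord).

Fixpoint ole (x y : Ord) : Prop :=
  match x, y with osup _ f, osup _ g => forall i, exists j, ole (f i) (g j) end.
Definition olt (x y : Ord) : Prop :=
  match y with osup _ g => exists j, ole x (g j) end.
Definition oeq (x y : Ord) : Prop := ole x y /\ ole y x.

Definition ozero : Ord := osup (fun e : void => match e with end).
Definition osucc (x : Ord) : Ord := osup (fun _ : unit => x).
Definition oone : Ord := osucc ozero.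
Definition olimit (x : Ord) : Prop :=
  olt ozero x /\ forall y, olt y x -> olt (osucc y) x.


Lemma ole_refl x : ole x x.
Proof. by elim: x => I f IH /= i; exists i. Qed.

Lemma ole_trans y x z : ole x y -> ole y z -> ole x z.
Proof.
elim: x y z => I f IH [J g] [K h] /= fg gh i.
have [j fgij] := fg i; have [k ghjk] := gh j.
by exists k; apply: IH fgij ghjk.
Qed.

Lemma oeq_sym x y : oeq x y -> oeq y x.
Proof. by case. Qed.

Lemma oeq_trans y x z : oeq x y -> oeq y z -> oeq x z.
Proof.
by move=> [xy yx] [yz zy]; split; apply: (@ole_trans y).
Qed.

Lemma oltE x y : olt x y <-> ole (osucc x) y.
Proof. by case: y => J g; split=> [? []|/(_ tt)]. Qed.

Lemma olt_le_trans y x z : olt x y -> ole y z -> olt x z.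
Proof. by rewrite !oltE; apply: ole_trans. Qed.

Lemma ole_lt_trans y x z : ole x y -> olt y z -> olt x z.
Proof.
by case: z => K h xy [k yhk]; exists k; apply: ole_trans yhk.
Qed.

Lemma olt_succ x : olt x (osucc x).
Proof. by exists tt; apply: ole_refl. Qed.

Lemma ole_succ x y : ole (osucc x) (osucc y) <-> ole x y.
Proof. by split=> [/(_ tt)[]|xy []] //; exists tt. Qed.

Lemma oeq_succ x y : oeq (osucc x) (osucc y) <-> oeq x y.
Proof. by rewrite /oeq !ole_succ. Qed.

Lemma olt_wf : well_founded olt.
Proof.
suff H x y : ole y x -> Acc olt y by move=> x; apply: (H x); apply: ole_refl.
elim: x y => I f IH y le_y; constructor=> z zy.
by have [i /IH] := olt_le_trans zy le_y.
Qed.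

Lemma olt_irr x : ~ olt x x.
Proof. by elim/(well_founded_induction olt_wf): x => x IH xx; apply: (IH x). Qed.

Lemma olimit_eq x y : oeq x y -> olimit x -> olimit y.
Proof.
move=> [xy yx] [x0 xS]; split=> [|z zy]; first exact: olt_le_trans xy.
by apply: olt_le_trans xy; apply: xS; apply: olt_le_trans yx.
Qed.

Lemma olimit_succ x y : olimit x -> ~ oeq x (osucc y).
Proof.
move=> [_ xS] [le_x ge_x]; apply: (@olt_irr x).
by apply: (ole_lt_trans le_x); apply: xS; apply/oltE.
Qed.

Fixpoint onat (n : nat) : Ord :=
  if n is n'.+1 then osucc (onat n') else ozero.
Definition omega : Ord := osup onat.

(* As sets of smaller ordinals,
   x + y = x `|` {x + d | d < y} and x * y = {x * c + d | c < y, d < x}. *)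
Fixpoint oadd (x y : Ord) : Ord :=
  match x, y with
  | osup A f, osup B g =>
      osup (fun s : A + B =>
              match s with inl a => f a | inr b => oadd x (g b) end)
  end.
Fixpoint omul (x y : Ord) : Ord :=
  match x, y with
  | osup A f, osup B g =>
      osup (fun p : B * A => oadd (omul x (g p.1)) (f p.2))
  end.

(* Well-founded recursion on ordinals. The value at 0 is a dummy; the defining
   equations of the series are [lcs1], [lcsS] and [lcs_limit]. *)
Definition lcs (G : groupType) : Ord -> set G :=
  Fix olt_wf (fun _ => set G) (fun x lcs_below => [set g |
    (forall y (yx : olt y x), ole oone y -> oeq x (osucc y) ->
       comm_subgroup (lcs_below y yx) [set: G] g) /\
    (forall y (yx : olt y x), ole oone y -> olimit x -> lcs_below y yx g)]).
Arguments lcs G _ : clear implicits.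

Section LowerCentralSeries.
Variable G : groupType.

Lemma lcsE x : lcs G x = [set g |
  (forall y, olt y x -> ole oone y -> oeq x (osucc y) ->
     comm_subgroup (lcs G y) [set: G] g) /\
  (forall y, olt y x -> ole oone y -> olimit x -> lcs G y g)].
Proof.
rewrite {1}/lcs Fix_eq // => {}x F F' FF'.
by have -> : F = F' by apply/functional_extensionality_dep => y;
  apply/functional_extensionality_dep => yx; apply: FF'.
Qed.

Lemma lcs_eq x y : oeq x y -> lcs G x = lcs G y.
Proof.
suff sub x' y' : oeq x' y' -> lcs G x' `<=` lcs G y'.
  by move=> xy; apply/seteqP; split; apply: sub => //; apply: oeq_sym.
move=> {x y} [xy yx]; rewrite !lcsE => z /= [zS zL]; split=> t ty t1.
  move=> yt; apply: zS => //; first exact: olt_le_trans yx.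
  exact: (@oeq_trans y').
move=> yL; apply: zL => //; first exact: olt_le_trans yx.
exact: (@olimit_eq y').
Qed.

Lemma lcs1 : lcs G oone = [set: G].
Proof.
apply/seteqP; split=> // z _; rewrite lcsE /=.
by split=> y y1 y_ge1; case: (@olt_irr y (@olt_le_trans oone y y y1 y_ge1)).
Qed.

Lemma lcsS x : ole oone x ->
  lcs G (osucc x) = comm_subgroup (lcs G x) [set: G].
Proof.
move=> x1; apply/seteqP; split=> z; rewrite (lcsE (osucc x)) /=.
  by move=> [+ _]; apply=> //; [exact: olt_succ|split; exact: ole_refl].
move=> zS; split=> y _ y1; [move=> yS|move=> xL].
  by rewrite -(lcs_eq (proj1 (oeq_succ _ _) yS)).
by case: (@olimit_succ _ x xL); split; exact: ole_refl.
Qed.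

Lemma lcs_limit x : olimit x ->
  lcs G x = \bigcap_(y in [set y | ole oone y /\ olt y x]) lcs G y.
Proof.
move=> xL; apply/seteqP; split=> z.
  by rewrite lcsE => /= -[_ zL] y [y1 yx]; apply: zL.
move=> zL; rewrite (lcsE x) /=; split=> y yx y1; first by move/(olimit_succ xL).
by move=> _; apply: zL.
Qed.

End LowerCentralSeries.

Definition lcs_length (G : groupType) (x : Ord) : Prop :=
  [/\ ole oone x, lcs G x = lcs G (osucc x) &
      forall y, ole oone y -> lcs G y = lcs G (osucc y) -> ole x y].

Definition gen_a : word bool := letter false.
Definition gen_b : word bool := letter true.

(* Conjugation x ^ y is y^-1 * (x * y); x ^+ n is the power. *)
Definition one_relator_group : groupType :=
  presented (fun l r : word bool =>
    l = gen_a ^ (gen_b ^+ 2) /\ r = gen_a * (gen_a ^+ 3) ^ gen_b).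

(* Main.v *)
(** In [G] the conjugates [a_i] of [a] by [b^i] satisfy
    [a_(i+2) = a_i a_(i+1)^3], so [G] is the extension of the free group [F] on
    [a_0, a_1] by the automorphism [a_0 |-> a_1], [a_1 |-> a_0 a_1^3], whose
    matrix on the abelianization of [F] has eigenvalues [lambda, mu] with
    [lambda mu = -1] and [lambda + mu = 3].

    Upper bound: the automorphism extends to the Magnus power series ring, and
    on the component of degree [n] it has the eigenvalues
    [+- lambda^k]. The norm of [+- lambda^k - 1] is never [+- 1], so an element
    of the [n]-th dimension subgroup of [F] that survives [omega] further
    commutations with [G] lies in the [(n+1)]-st one. Hence the term of index
    [omega * n] of the lower central series lies in the [n]-th dimension
    subgroup, and these intersect trivially by Magnus' theorem.

    Lower bound: in a nilpotent quotient of [G] the image of [F] is abelian, so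
    [[F, F]] lies in the term of index [omega]. By the three subgroup lemma the
    term of index [omega * (n+1)] then contains the commutators of the term of
    index [omega * n] with [[F, F]], and suitable iterated commutators are
    nontrivial because a homomorphism from [F] to the symmetric group on five
    points sends all of them to the same 3-cycle. *)
From HB Require Import structures.
From mathcomp Require Import all_boot all_algebra perm.
From mathcomp Require Import zify ring.
From mathcomp Require Import boolp classical_sets functions.
Require Import Defs.

Set Implicit Arguments.
Unset Strict Implicit.
Unset Printing Implicit Defensive.
Local Open Scope group_scope.
Local Open Scope classical_set_scope.

(** * Commutator subgroups *)

Section Subgroups.
Variable G : groupType.
Implicit Types (H K : set G) (x y g : G).

Lemma subgroup_set1 H : subgroup_set H -> H 1.
Proof. by case. Qed.

Lemma subgroup_setV H x : subgroup_set H -> H x -> H x^-1.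
Proof. by move=> [H1 HD] Hx; rewrite -div1g; apply: HD. Qed.

Lemma subgroup_setM H x y : subgroup_set H -> H x -> H y -> H (x * y).
Proof.
by move=> sH Hx Hy; rewrite -[y]invgK; apply: (sH.2) => //; apply: subgroup_setV.
Qed.

Lemma subgroup_setX H x n : subgroup_set H -> H x -> H (x ^+ n).
Proof.
move=> sH Hx; elim: n => [|n IHn]; first exact: subgroup_set1.
by rewrite expgS; apply: subgroup_setM.
Qed.

Lemma subgroup_setP H :
    H 1 -> (forall x y, H x -> H y -> H (x * y)) ->
    (forall x, H x -> H x^-1) -> subgroup_set H.
Proof. by move=> H1 HM HV; split=> // x y Hx Hy; apply/HM/HV. Qed.

Lemma smallest_subgroup H : subgroup_set (smallest (@subgroup_set G) H).
Proof.
split=> [|x y Hx Hy] K [sK HK]; first exact: subgroup_set1.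
by apply: sK.2; [apply: Hx|apply: Hy].
Qed.

Definition normal_set H := subgroup_set H /\ forall x g, H x -> H (x ^ g).

Lemma normal_setT : normal_set setT.
Proof. by []. Qed.

Lemma normal_set_comm H x g : normal_set H -> H x -> H [~ x, g].
Proof.
move=> [sH HJ] Hx; rewrite commgEl.
by apply: subgroup_setM => //; [apply: subgroup_setV|apply: HJ].
Qed.

Lemma comm_subgroup_mem H x g : H x -> comm_subgroup H setT [~ x, g].
Proof. by move=> Hx K [_ /(_ [~ x, g])]; apply; exists x => //; exists g. Qed.

Lemma comm_subgroup_sub H K :
    subgroup_set K -> (forall x g, H x -> K [~ x, g]) ->
  comm_subgroup H setT `<=` K.
Proof.
by move=> sK HK z /(_ K); apply; split=> // _ [x Hx] [g _ <-]; apply: HK.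
Qed.

Lemma comm_subgroup_normal H : normal_set H -> normal_set (comm_subgroup H setT).
Proof.
move=> nH; have sC : subgroup_set (comm_subgroup H setT).
  exact: smallest_subgroup.
split=> // x g Cx; pose K := [set z : G | comm_subgroup H setT (z ^ g)].
suff: comm_subgroup H setT `<=` K by apply.
apply: comm_subgroup_sub => [|y h Hy]; last first.
  by rewrite /K /= conjRg; apply: comm_subgroup_mem; apply: nH.2.
apply: subgroup_setP => [|y z|y]; rewrite /K /= ?conj1g ?conjMg ?conjVg.
- exact: subgroup_set1.
- exact: subgroup_setM.
- exact: subgroup_setV.
Qed.

Lemma comm_subgroup_subl H : normal_set H -> comm_subgroup H setT `<=` H.
Proof.
by move=> nH; apply: comm_subgroup_sub => [|x g]; [case: nH|apply: normal_set_comm].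
Qed.

Definition gamma H n := iter n (fun K => comm_subgroup K setT) H.

Lemma gammaSr H n : gamma H n.+1 = gamma (comm_subgroup H setT) n.
Proof. by rewrite /gamma iterSr. Qed.

Lemma gamma_normal H n : normal_set H -> normal_set (gamma H n).
Proof. by move=> nH; elim: n => //= n; apply: comm_subgroup_normal. Qed.

(** The quotient is presented by all elements of [G], with a relation between any two words that
    evaluate to the same coset of [N]. *)
Lemma quotient_exists N : normal_set N ->
  exists (Q : groupType) (f : UMagmaMorphism.type G Q),
    forall x, f x = 1 <-> N x.
Proof.
move=> [sN nN].
pose ev (w : word G) : G := \prod_(l <- w) (if l.2 then l.1^-1 else l.1).
have evM u v : ev (u * v) = ev u * ev v by rewrite /ev big_cat.
pose R (l r : word G) := N ((ev l)^-1 * ev r).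
have Rcong u v : word_cong R u v -> N ((ev u)^-1 * ev v).
  elim=> {u v}.
  - move=> u v l r Rlr; rewrite !evM !invgM !mulgA mulgVK.
    by have:= nN _ (ev v) Rlr; rewrite conjgE !mulgA.
  - move=> u v x e; rewrite !evM.
    have -> : ev [:: (x, e); (x, ~~ e)] = 1.
      rewrite /ev big_cons big_seq1; case: e => /=; [exact: mulVg|exact: mulgV].
    by rewrite mulg1 mulVg; apply: subgroup_set1.
  - by move=> u; rewrite mulVg; apply: subgroup_set1.
  - by move=> u v _ /(subgroup_setV sN); rewrite invgM invgK.
  - move=> u v w _ Nuv _ Nvw; have:= subgroup_setM sN Nuv Nvw.
    by rewrite mulgA mulgK.
pose f x : presented R := pres_class R (letter x).
have fM : {morph f : x y / x * y}.
  move=> x y; rewrite /f -[RHS](pres_classM R (letter x) (letter y)).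
  apply/pres_classP.
  apply: (@wc_rel _ R 1 1 (letter (x * y)) (letter x * letter y)).
  by rewrite /R evM /ev !big_seq1 mulVg; apply: subgroup_set1.
have f1 : f 1 = 1 by apply: (mulgI (f 1)); rewrite -fM !mulg1.
pose fmor := UMagmaMorphism.Pack (UMagmaMorphism.Class
  (Multiplicative_isUMagmaMorphism.Build _ _ f f1)
  (isMultiplicative.Build _ _ f fM)).
exists (presented R), fmor => x; split.
  move/(pres_classP R (letter x) 1)/Rcong/(subgroup_setV sN).
  by rewrite /ev big_seq1 big_nil mulg1 invgK.
move=> Nx; apply/(pres_classP R (letter x) 1).
apply: (@wc_rel _ R 1 1 (letter x) 1).
by rewrite /R /ev big_seq1 big_nil mulg1; apply: subgroup_setV.
Qed.

Lemma conj_commute (x y : G) : commute x y -> x ^ y = x.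
Proof. by move=> /commgP/conjg_fixP. Qed.

(** Conjugation by [z] and by [z ^ g] both multiply [x ^ g] by [[~ x, z]], so [[~ z, g] = z^-1 * z ^
    g] centralizes [x ^ g]. *)
Lemma three_subgroup_elt (x z g : G) :
    commute [~ x, z] x -> commute [~ x, z] z -> commute [~ x, z] g ->
    commute [~ x, g] z ->
  [~ x ^ g, [~ z, g]] = 1.
Proof.
set c := [~ x, z]; set d := [~ x, g] => cx cz cg dz.
have xzE : x ^ z = x * c by rewrite /c commgEl mulVKg.
have xgE : x ^ g = x * d by rewrite /d commgEl mulVKg.
have cxg : commute c (x ^ g).
  by rewrite /commute -{1}(conj_commute cg) -{2}(conj_commute cg) -!conjMg cx.
have cd : commute c d.
  by rewrite /d commgEl; apply: commuteM => //; apply: commuteV.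
have czg : commute c (z ^ g).
  by rewrite /commute -{1}(conj_commute cg) -{2}(conj_commute cg) -!conjMg cz.
have yz : (x ^ g) ^ z = x ^ g * c.
  by rewrite xgE conjMg xzE (conj_commute dz) -(mulgA x c) cd mulgA.
have yzg : (x ^ g) ^ (z ^ g) = x ^ g * c.
  by rewrite -conjJg xzE conjMg (conj_commute cg).
have yzV : (x ^ g) ^ z^-1 = x ^ g * c^-1.
  apply: (conjg_inj z); rewrite conjgKV conjMg yz conjVg (conj_commute cz).
  by rewrite mulgK.
apply/eqP/conjg_fixP; rewrite commgEl conjgM yzV conjMg yzg.
by rewrite conjVg (conj_commute czg) mulgK.
Qed.

End Subgroups.

(** Three subgroup lemma modulo [gamma H n.+2]. The induction leaves [H] free because it is also
    applied to [comm_subgroup H setT]. *)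
Lemma comm_gamma (G : groupType) (H : set G) n x y :
    normal_set H -> H x -> gamma setT n y ->
  gamma H n.+1 [~ x, y].
Proof.
elim: n H x y => [|n IHn] H x y nH Hx; first by move=> _; apply: comm_subgroup_mem.
set N := gamma H n.+2.
have nN : normal_set N by apply: gamma_normal.
have [Q [f fker]] := quotient_exists nN.
pose K := [set u : G | forall x, H x -> N [~ x, u]].
suff: comm_subgroup (gamma setT n) setT `<=` K by move=> + Ky => /(_ _ Ky); apply.
have commK x' u : N [~ x', u] <-> commute (f x') (f u).
  by rewrite -fker gmulfR; split=> [/eqP/commgP|/commgP/eqP].
apply: comm_subgroup_sub.
  apply: subgroup_setP => [z Hz|u v Ku Kv z Hz|u Ku z Hz].
  - by rewrite commg1; apply: subgroup_set1 nN.1.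
  - by apply/commK; rewrite gmulfM; apply: commuteM; apply/commK; auto.
  - by apply/commK; rewrite gmulfV; apply: commuteV; apply/commK; apply: Ku.
move=> z g Gz x' Hx'.
have cent u v : H u -> commute (f [~ u, z]) (f v).
  by move=> Hu; apply/commK; apply: comm_subgroup_mem; apply: IHn.
(* [three_subgroup_elt] speaks of a conjugate by [g], so [x'] is written as [(x' ^ g^-1) ^ g]. *)
have Hxg : H (x' ^ g^-1) by apply: nH.2.
apply/fker; rewrite -[x'](conjgKV g) !gmulfR gmulfJ.
apply: three_subgroup_elt; rewrite -?gmulfR; try exact: cent.
apply/commK; rewrite /N gammaSr; apply: IHn => //.
  exact: comm_subgroup_normal.
exact: comm_subgroup_mem.
Qed.

Lemma commgMr (G : groupType) (x y z : G) :
  [~ x, y * z] = [~ x, z] * [~ x, y] ^ z.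
Proof.
by rewrite !commgEl conjMg conjgM conjVg -(mulgA x^-1) mulVKg.
Qed.

Lemma commute_subgroup (G Q : groupType) (f : UMagmaMorphism.type G Q) (q : Q) :
  subgroup_set [set x | commute q (f x)].
Proof.
apply: subgroup_setP => [|x y|x]; rewrite /= ?gmulf1 ?gmulfM ?gmulfV.
- exact: commute1.
- exact: commuteM.
- exact: commuteV.
Qed.

(** * The normal closure of [a] and its derived subgroup *)

Section BaseRelation.
Variables (G : groupType) (a b : G).
Hypothesis gen : forall K : set G, subgroup_set K -> K a -> K b -> forall x, K x.
Hypothesis rel : a ^ (b ^+ 2) = a * (a ^+ 3) ^ b.

Let a1 := a ^ b.

(** By the relation these two generators already generate the normal closure of [a]. *)
Definition fiber : set G := smallest (@subgroup_set G) [set x | x = a \/ x = a1].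

Lemma fiber_subgroup : subgroup_set fiber.
Proof. exact: smallest_subgroup. Qed.

Lemma fiber_gen0 : fiber a.
Proof. by move=> K [_]; apply; left. Qed.

Lemma fiber_gen1 : fiber a1.
Proof. by move=> K [_]; apply; right. Qed.

Lemma fiber_ind K : subgroup_set K -> K a -> K a1 -> fiber `<=` K.
Proof. by move=> sK Ka Ka1 x; apply; split=> // _ [] ->. Qed.

Lemma conj_gen1 : a1 ^ b = a * a1 ^+ 3.
Proof. by rewrite -conjgM -expg2 rel conjXg. Qed.

Lemma conj_set_subgroup (K : set G) g :
  subgroup_set K -> subgroup_set [set x | K (x ^ g)].
Proof.
move=> sK; apply: subgroup_setP => [|x y|x]; rewrite /= ?conj1g ?conjMg ?conjVg.
- exact: subgroup_set1.
- exact: subgroup_setM.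
- exact: subgroup_setV.
Qed.

Lemma fiber_normal : normal_set fiber.
Proof.
have sF := fiber_subgroup; split=> // x g Fx.
(* Both conjugations are required so that [K] is closed under inverses. *)
pose K := [set h : G | forall x, fiber x -> fiber (x ^ h) /\ fiber (x ^ h^-1)].
suff sK : subgroup_set K.
  apply: (gen sK _ _ g _ Fx).1 => {Fx}x Fx.
    have Fa := fiber_gen0; have FV := subgroup_setV sF Fa.
    by split; rewrite conjgE ?invgK; do 2!apply: (subgroup_setM sF) => //.
  split; move: x Fx; apply: fiber_ind.
  - exact: conj_set_subgroup.
  - exact: fiber_gen1.
  - rewrite /= conj_gen1; apply: (subgroup_setM sF) => //; first exact: fiber_gen0.
    exact (subgroup_setX 3 sF fiber_gen1).
  - exact: conj_set_subgroup.
  - have -> : (a ^ b^-1) = a1 / a ^+ 3.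
      apply: (conjg_inj b); rewrite conjgKV conjMg conj_gen1 conjVg conjXg.
      by rewrite mulgK.
    apply: (sF.2); first exact: fiber_gen1.
    exact (subgroup_setX 3 sF fiber_gen0).
  - by rewrite /= conjgK; apply: fiber_gen0.
apply: subgroup_setP => [y|y z Ky Kz u Fu|y Ky u Fu].
- by rewrite invg1 !conjg1.
- rewrite invgM !conjgM; split; first by apply: (Kz _ _).1; apply: (Ky _ _).1.
  by apply: (Ky _ _).2; apply: (Kz _ _).2.
- by rewrite invgK; have [] := Ky u Fu.
Qed.

(** Modulo the fiber, [G] is generated by the image of [b], hence abelian. *)
Lemma gamma1_sub_fiber : gamma setT 1 `<=` fiber.
Proof.
have [Q [f fker]] := quotient_exists fiber_normal.
have fa : f a = 1 by apply/fker; apply: fiber_gen0.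
have cent_sub u := commute_subgroup f (f u).
have commb x : commute (f b) (f x).
  by apply: gen (cent_sub b) _ _ x => /=; rewrite ?fa; [exact: commute1|].
apply: comm_subgroup_sub; first exact: fiber_subgroup.
move=> x y _; apply/fker; rewrite gmulfR; apply/eqP/commgP.
apply: gen (cent_sub x) _ _ y => /=; last exact/commute_sym.
by rewrite fa; exact: commute1.
Qed.

(* Modulo [gamma setT m.+1] the derived subgroup of the fiber is central, so
   [h x = [~ a, x]] is a homomorphism on the fiber. Its square is trivial
   because conjugation by [b] has determinant -1 on the abelianization, and
   its cube is trivial on every [x] with [h [~ x, b] = 1] because of the
   relation [x^(b^2) = x * (x^3)^b] modulo the derived subgroup; descending
   along the lower central series, [h] is trivial. *)
Lemma fiber_comm_gamma m x y : fiber x -> fiber y -> gamma setT m [~ x, y].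
Proof.
have sF := fiber_subgroup; have nF := fiber_normal.
elim: m x y => [//|m IHm] x y Fx Fy.
have nN : normal_set (gamma [set: G] m.+1) by apply: gamma_normal.
have [Q [f fker]] := quotient_exists nN.
have cent u v g : fiber u -> fiber v -> commute (f [~ u, v]) (f g).
  move=> Fu Fv; apply/commgP/eqP; rewrite -gmulfR; apply/fker.
  by apply: comm_subgroup_mem; apply: IHm.
pose h u := f [~ a, u].
have Fa := fiber_gen0; have Fa1 := fiber_gen1.
have hM u v : fiber u -> fiber v -> h (u * v) = h u * h v.
  move=> Fu Fv; rewrite /h commgMr gmulfM gmulfJ (conj_commute (cent _ _ _ _ _)) //.
  by apply: commute_sym; apply: cent.
have h1 : h 1 = 1 by rewrite /h commg1 gmulf1.
have hV u : fiber u -> h u^-1 = (h u)^-1.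
  move=> Fu; apply/esym/mulg1_eq; rewrite -hM ?mulgV //.
  exact: (subgroup_setV sF).
have hC u v : fiber u -> commute (h u) (h v) by move=> Fu; apply: cent.
have ha : h a = 1 by rewrite /h commgg gmulf1.
have hX u n : fiber u -> h (u ^+ n) = h u ^+ n.
  move=> Fu; elim: n => [//|n IHn]; rewrite !expgS hM ?IHn //.
  exact (subgroup_setX n sF Fu).
(* Conjugation by [b] fixes the image of [[~ a, a1]], which is central, but sends [[~ a, a1]] to
   [[~ a1, a * a1 ^+ 3]], whose image is the inverse. *)
have ha1 : h a1 ^+ 2 = 1.
  have: f ([~ a, a1] ^ b) = h a1.
    by rewrite gmulfJ conj_commute //; apply: cent.
  rewrite conjRg -/a1 conj_gen1 commgMr commgXg mul1g -invgR gmulfJ.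
  rewrite conj_commute; last first.
    by rewrite gmulfV; apply: commute_sym; apply: commuteV; apply: commute_sym;
      apply: cent.
  by rewrite gmulfV -/(h a1) => hV1; rewrite expg2 -{1}hV1 mulVg.
have hsq u : fiber u -> h u ^+ 2 = 1.
  have comm2 v w : fiber v -> fiber w -> h (v * w) ^+ 2 = h v ^+ 2 * h w ^+ 2.
    by move=> Fv Fw; rewrite hM // expgMn //; apply: cent.
  pose K := [set u | fiber u /\ h u ^+ 2 = 1].
  suff: fiber `<=` K by move=> FK /FK[].
  apply: fiber_ind; rewrite /K /=; last 2 first.
  - by rewrite ha expg1n.
  - by [].
  apply: subgroup_setP => [|v w [Fv hv] [Fw hw]|v [Fv hv]] /=.
  - by rewrite h1 expg1n; split=> //; apply: (subgroup_set1 sF).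
  - by rewrite comm2 // hv hw mulg1; split=> //; apply: (subgroup_setM sF).
  - by rewrite hV // expVgn hv invg1; split=> //; apply: (subgroup_setV sF).
have hrel u : fiber u -> h (u ^ (b ^+ 2)) = h u * h (u ^ b) ^+ 3.
  have hJ v g : fiber v -> fiber (v ^ g) by apply: nF.2.
  pose K := [set u | fiber u /\ h (u ^ (b ^+ 2)) = h u * h (u ^ b) ^+ 3].
  suff: fiber `<=` K by move=> FK /FK[].
  apply: fiber_ind; rewrite /K /=; last 2 first.
  - rewrite rel conjXg -/a1 hM ?hX //.
    exact (subgroup_setX 3 sF Fa1).
  - split=> //; rewrite expg2 conjgM conj_gen1 conjMg -/a1 conjXg conj_gen1.
    have Fa2 : fiber (a * a1 ^+ 3) by rewrite -conj_gen1; apply: hJ.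
    have Fa13 := subgroup_setX 3 sF Fa1; have Fa23 := subgroup_setX 3 sF Fa2.
    by rewrite [LHS]hM ?[in LHS]hX.
  apply: subgroup_setP => [|v w [Fv hv] [Fw hw]|v [Fv hv]] /=.
  - by rewrite !conj1g h1 expg1n mulg1; split=> //; apply: (subgroup_set1 sF).
  - split; first exact: (subgroup_setM sF).
    rewrite !conjMg (hM v w) // (hM (v ^ b)) ?(hM (v ^ (b ^+ 2))); try by auto.
    rewrite hv hw expgMn; last by apply: hC; auto.
    have hwv : commute (h w) (h (v ^ b) ^+ 3) by apply/commuteX/hC.
    move: (h v) (h w) (h (v ^ b) ^+ 3) (h (w ^ b) ^+ 3) hwv => p q r s qr.
    by rewrite !mulgA -(mulgA p) -qr mulgA.
  - split; first exact: (subgroup_setV sF).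
    rewrite !conjVg (hV v) // (hV (v ^ b)) ?(hV (v ^ (b ^+ 2))) ?hv; try by auto.
    have -> : h v * h (v ^ b) ^+ 3 = h (v ^ b) ^+ 3 * h v by apply/commuteX/hC.
    by rewrite expVgn invgM.
have desc n : (n <= m)%N -> forall u, fiber u -> gamma setT (m - n) u -> h u = 1.
  elim: n => [_|n IHn lenm] u Fu Gu.
    rewrite subn0 in Gu; rewrite /h -invgR gmulfV.
    suff -> : f [~ u, a] = 1 by rewrite invg1.
    by apply/fker; apply: comm_subgroup_mem.
  have hb v : fiber v -> gamma setT (m - n.+1) v -> h (v ^ b) = h v.
    move=> Fv Gv; have -> : v ^ b = v * [~ v, b] by rewrite commgEl mulVKg.
    have Fvb : fiber [~ v, b] by apply: (normal_set_comm b nF).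
    rewrite hM // (IHn (ltnW lenm) [~ v, b]) ?mulg1 //.
    have -> : (m - n = (m - n.+1).+1)%N by rewrite subnSK.
    exact: comm_subgroup_mem.
  (* Here [hrel] reads [h u = h u * h u ^+ 3], and [h u ^+ 3 = h u] by [hsq]. *)
  have := hrel u Fu; rewrite expg2 conjgM (hb (u ^ b)) ?hb //; last 2 first.
  - exact: nF.2.
  - by apply: (gamma_normal _ (normal_setT G)).2.
  rewrite expgSr hsq // mul1g => /esym; rewrite -{3}[h u]mulg1.
  exact: mulgI.
have hall u : fiber u -> h u = 1.
  by move=> Fu; apply: (desc m) => //; rewrite subnn.
have comm_sub u := commute_subgroup f (f u).
have fa0 u : fiber u -> commute (f a) (f u).
  by move=> Fu; apply/commgP/eqP; rewrite -gmulfR; apply: hall.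
have fa1 u : fiber u -> commute (f a1) (f u).
  move=> Fu; apply: (fiber_ind (comm_sub a1) _ _ Fu) => //=.
  exact/commute_sym/fa0.
apply/fker; rewrite gmulfR; apply/eqP/commgP.
by apply: (fiber_ind (comm_sub x) _ _ Fy) => /=; apply: commute_sym; auto.
Qed.
End BaseRelation.

(** * Ordinals below [omega ^ 2] *)

Lemma ole_total x y : ole x y \/ olt y x.
Proof.
elim: x y => I f IH [J g].
have [lt_fg|/existsNP[i not_lt]] := pselect (forall i, olt (f i) (osup g)).
  by left.
have lt_gf j : olt (g j) (f i).
  by have [le_fg|//] := IH i (g j); case: not_lt; exists j.
by right; exists i; case: (f i) lt_gf.
Qed.

Lemma ole0 x : ole ozero x.
Proof. by case: x => J g []. Qed.

Lemma olt_le x y : olt x y -> ole x y.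
Proof.
elim: y x => J g IH x [j xg]; apply: ole_trans xg _.
case E: (g j) => [K h] k /=; exists j.
by apply: (IH j); rewrite E; exists k; exact: ole_refl.
Qed.

Lemma olt_succ_or_limit x :
  olt ozero x -> (exists y, oeq x (osucc y)) \/ olimit x.
Proof.
move=> x0; have [xS|not_S] := pselect (exists y, oeq x (osucc y)); first by left.
right; split=> // y yx; have [le_xS|//] := ole_total x (osucc y).
by case: not_S; exists y; split=> //; apply/oltE.
Qed.

Lemma ole_add x y : ole x (oadd x y).
Proof.
case: x y => A f [B g] a; exists (inl a); exact: ole_refl.
Qed.

Lemma oadd0 x : oeq (oadd x ozero) x.
Proof.
split; last exact: ole_add.
by case: x => A f [a|[]]; exists a; exact: ole_refl.
Qed.

Lemma oaddS x y : oeq (oadd x (osucc y)) (osucc (oadd x y)).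
Proof.
case: x => A f; split=> [[a|[]]|[]].
- exists tt; apply: ole_trans (ole_add (osup f) y).
  by apply: olt_le; exists a; exact: ole_refl.
- by exists tt; exact: ole_refl.
- by exists (inr tt); exact: ole_refl.
Qed.

Section OmegaSquare.
Variable G : groupType.
Implicit Types (x y z : Ord) (g : G).

Lemma normal_set_bigcap (I : Type) (P : I -> Prop) (H : I -> set G) :
  (forall i, P i -> normal_set (H i)) -> normal_set [set g | forall i, P i -> H i g].
Proof.
move=> nH; split; first split=> [i Pi|g h Hg Hh i Pi].
- exact: (nH i Pi).1.1.
- by apply: (nH i Pi).1.2; [apply: Hg|apply: Hh].
- by move=> g h Hg i Pi; apply: (nH i Pi).2; apply: Hg.
Qed.

Lemma lcs_normal x : normal_set (lcs G x).
Proof.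
elim/(well_founded_induction olt_wf): x => x IH.
pose P y := [/\ olt y x, ole oone y & oeq x (osucc y)].
pose P' y := [/\ olt y x, ole oone y & olimit x].
have n1 : normal_set [set g | forall y, P y -> comm_subgroup (lcs G y) setT g].
  by apply: normal_set_bigcap => y [yx _ _]; apply: comm_subgroup_normal; apply: IH.
have n2 : normal_set [set g | forall y, P' y -> lcs G y g].
  by apply: normal_set_bigcap => y [yx _ _]; apply: IH.
have -> : lcs G x = [set g | forall y, P y -> comm_subgroup (lcs G y) setT g]
                  `&` [set g | forall y, P' y -> lcs G y g].
  rewrite lcsE; apply/seteqP; split=> g [/= g1 g2]; split=> y.
  - by case=> yx y1 xS; apply: g1.
  - by case=> yx y1 xL; apply: g2.
  - by move=> yx y1 xS; apply: g1.
  - by move=> yx y1 xL; apply: g2.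
split; first split; first by split; [exact: n1.1.1|exact: n2.1.1].
  by move=> g h [g1 g2] [h1 h2]; split; [apply: n1.1.2|apply: n2.1.2].
by move=> g h [g1 g2]; split; [apply: n1.2|apply: n2.2].
Qed.

Lemma lcs_antitone x y : ole oone x -> ole x y -> lcs G y `<=` lcs G x.
Proof.
move=> x1; elim/(well_founded_induction olt_wf): y => y IH xy.
have [yx|lt_xy] := ole_total y x; first by rewrite (@lcs_eq _ y x).
have y0 : olt ozero y by apply: ole_lt_trans lt_xy; exact: ole0.
have [[z yS]|yL] := olt_succ_or_limit y0.
  have xz : ole x z by apply/ole_succ/(ole_trans _ yS.1)/oltE.
  rewrite (lcs_eq _ yS) lcsS; last exact: ole_trans xz.
  apply: subset_trans (IH z _ xz); last first.
    by apply: olt_le_trans yS.2; exact: olt_succ.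
  by apply: comm_subgroup_subl; exact: lcs_normal.
by rewrite (lcs_limit _ yL) => g; apply.
Qed.

(** By transfinite induction, one stationary step makes the series constant from there on; this is
    what excludes a smaller length. *)
Lemma lcs_stable x z : ole oone x -> lcs G x = lcs G (osucc x) -> ole x z ->
  lcs G x `<=` lcs G z.
Proof.
move=> x1 xE; elim/(well_founded_induction olt_wf): z => z IH xz.
have [zx|lt_xz] := ole_total z x; first by rewrite (@lcs_eq _ z x).
have z0 : olt ozero z by apply: ole_lt_trans lt_xz; exact: ole0.
have [[w zS]|zL] := olt_succ_or_limit z0.
  have xw : ole x w by apply/ole_succ/(ole_trans _ zS.1)/oltE.
  have sub : lcs G x `<=` lcs G w.
    by apply: IH => //; apply: olt_le_trans zS.2; exact: olt_succ.
  rewrite (lcs_eq _ zS) lcsS; last exact: ole_trans xw.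
  rewrite {1}xE (lcsS _ x1); apply: comm_subgroup_sub => [|g h xg].
    exact: smallest_subgroup.
  by apply: comm_subgroup_mem; apply: sub.
rewrite (lcs_limit _ zL) => g xg w [w1 wz].
have [xw|wx] := ole_total x w; first exact: IH.
by apply: lcs_antitone xg => //; apply: olt_le.
Qed.

Lemma lcs_addn x n : ole oone x -> lcs G (oadd x (onat n)) = gamma (lcs G x) n.
Proof.
move=> x1; elim: n => [|n IHn]; first by apply: lcs_eq; exact: oadd0.
rewrite (lcs_eq _ (oaddS x (onat n))) lcsS ?IHn //.
exact: ole_trans (ole_add _ _).
Qed.

Definition omega_mul n := omul omega (onat n).

Lemma olt_omega_mulS n x :
  olt x (omega_mul n.+1) <-> exists m, ole x (oadd (omega_mul n) (onat m)).
Proof. by split=> [[[[] m] xm]|[m xm]]; [exists m|exists (tt, m)]. Qed.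

Lemma olimit_omega_mulS n : olimit (omega_mul n.+1).
Proof.
split=> [|y]; first by apply/olt_omega_mulS; exists 0; exact: ole0.
move=> /olt_omega_mulS[m ym]; apply/olt_omega_mulS; exists m.+1.
by apply: ole_trans (oaddS _ _).2; apply/ole_succ.
Qed.

Lemma ole1_omega_mulS n : ole oone (omega_mul n.+1).
Proof. by have [+ _] := olimit_omega_mulS n; rewrite oltE. Qed.

Definition gamma_omega (H : set G) : set G := [set g | forall n, gamma H n g].

Lemma gamma_omega_normal H : normal_set H -> normal_set (gamma_omega H).
Proof.
move=> nH.
have -> : gamma_omega H = [set g | forall n, True -> gamma H n g].
  by apply/seteqP; split=> g Hg n; [move=> _|have := Hg n]; auto.
by apply: normal_set_bigcap => n _; apply: gamma_normal.
Qed.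

(* The shift [k] accounts for the series starting at the ordinal 1. *)
Lemma lcs_omega_mul_step n (H : set G) k :
    (forall m, ole oone (oadd (omega_mul n) (onat (m + k)))) ->
    (forall m, lcs G (oadd (omega_mul n) (onat (m + k))) = gamma H m) ->
  lcs G (omega_mul n.+1) = gamma_omega H.
Proof.
move=> le1k eqU.
rewrite (lcs_limit _ (olimit_omega_mulS n)); apply/seteqP; split=> g Hg.
  move=> m; rewrite -eqU; apply: Hg; split=> //.
  by apply/olt_omega_mulS; exists (m + k)%N; exact: ole_refl.
move=> y [y1 /olt_omega_mulS[m ym]].
have: lcs G (oadd (omega_mul n) (onat (m + k))) g by rewrite eqU.
apply: lcs_antitone => //; apply: ole_trans ym _.
elim: k {le1k eqU} => [|k IHk]; first by rewrite addn0; exact: ole_refl.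
rewrite addnS; apply: ole_trans (oaddS _ _).2.
exact: ole_trans IHk (olt_le (olt_succ _)).
Qed.

Lemma oadd_omega_mul0 : oeq (oadd (omega_mul 0) oone) oone.
Proof.
apply: oeq_trans (oaddS _ _) _; apply/oeq_succ; apply: oeq_trans (oadd0 _) _.
by split=> [[[] []]|[]].
Qed.

Lemma ole1_add x m : ole oone (oadd x (onat m.+1)).
Proof.
apply: ole_trans (oaddS _ _).2; apply/ole_succ; exact: ole0.
Qed.

Lemma lcs_omega_mul n : lcs G (omega_mul n.+1) = iter n.+1 gamma_omega setT.
Proof.
elim: n => [|n IHn].
  (* The series has a dummy value at [omega_mul 0], so the first block starts at the ordinal 1. *)
  apply: (@lcs_omega_mul_step _ setT 1) => m; rewrite addn1; first exact: ole1_add.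
  elim: m => [|m IHm]; first by rewrite (lcs_eq _ oadd_omega_mul0) lcs1.
  by rewrite (lcs_eq _ (oaddS _ _)) lcsS ?IHm //; exact: ole1_add.
apply: (@lcs_omega_mul_step _ _ 0) => m; rewrite addn0.
  exact: ole_trans (ole1_omega_mulS n) (ole_add _ _).
by rewrite lcs_addn ?IHn //; exact: ole1_omega_mulS.
Qed.


(** A stationary index below [omega ^ 2] is at most some [omega_mul n.+1]; the term there, which has
    a nontrivial element, would be contained in the trivial term of index [omega ^ 2]. *)
Lemma lcs_length_omega2 :
    (forall n, exists2 g, iter n.+1 gamma_omega [set: G] g & g <> 1) ->
    (forall g, (forall n, iter n gamma_omega [set: G] g) -> g = 1) ->
  lcs_length G (omul omega omega).
Proof.
move=> neq1 eq1.
have ltP y : olt y (omul omega omega) -> exists n, ole y (omega_mul n.+1).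
  by move=> [[n m] /= ym]; exists n; apply: olt_le; apply/olt_omega_mulS; exists m.
have le_omega n : ole (omega_mul n.+1) (omul omega omega).
  by move=> [[] m]; exists (n, m); exact: ole_refl.
have w1 : ole oone (omul omega omega).
  exact: ole_trans (ole1_omega_mulS 0) (le_omega 0%N).
have lcs_eq1 g : lcs G (omul omega omega) g -> g = 1.
  move=> Gg; apply: eq1 => -[//|n]; rewrite -lcs_omega_mul.
  by apply: lcs_antitone Gg => //; exact: ole1_omega_mulS.
split=> //.
  rewrite (lcsS _ w1); apply/seteqP; split=> g.
    by move=> /lcs_eq1 ->; apply: (comm_subgroup_normal (lcs_normal _)).1.1.
  by apply: comm_subgroup_subl; exact: lcs_normal.
move=> y y1 yE; have [//|/ltP[n yn]] := ole_total (omul omega omega) y.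
have [g Hg g1] := neq1 n; case: g1; apply: lcs_eq1.
apply: (lcs_stable y1 yE).
  exact: ole_trans yn (le_omega n).
by rewrite -lcs_omega_mul in Hg; apply: lcs_antitone Hg.
Qed.
End OmegaSquare.

(** * Actions of the one-relator group *)

Section PresentedAction.
Variables (X : choiceType) (R : word X -> word X -> Prop).
Variables (T : Type) (f : X * bool -> T -> T).

Definition word_act (w : word X) (t : T) : T := foldr f t w.

Hypothesis fK : forall x e t, f (x, e) (f (x, ~~ e) t) = t.
Hypothesis fR : forall l r, R l r -> word_act l =1 word_act r.

Lemma word_actM (u v : word X) t : word_act (u * v) t = word_act u (word_act v t).
Proof. exact: foldr_cat. Qed.

(** Von Dyck's theorem for actions. *)
Lemma word_act_cong u v : word_cong R u v -> word_act u =1 word_act v.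
Proof.
elim=> {u v}.
- by move=> u v l r Rlr t; rewrite !word_actM (fR Rlr).
- by move=> u v x e t; rewrite !word_actM /= fK.
- by [].
- by move=> u v _ IH t; rewrite IH.
- by move=> u v w _ IHu _ IHv t; rewrite IHu.
Qed.

Definition pres_act (g : presented R) : T -> T := word_act (pres_repr g).

Lemma pres_act_class u : pres_act (pres_class R u) =1 word_act u.
Proof. by apply: word_act_cong; apply/pres_classP; rewrite pres_reprK. Qed.

Lemma pres_actM g h t : pres_act (g * h) t = pres_act g (pres_act h t).
Proof.
rewrite -[g in LHS](pres_reprK g) -[h in LHS](pres_reprK h).
by rewrite -[_ * _](pres_classM R) pres_act_class word_actM.
Qed.

Lemma pres_act1 t : pres_act 1 t = t.
Proof. exact: (pres_act_class [::]). Qed.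

Lemma pres_actK g t : pres_act g^-1 (pres_act g t) = t.
Proof. by rewrite -pres_actM mulVg pres_act1. Qed.

End PresentedAction.

Lemma pres_gen (X : choiceType) (R : word X -> word X -> Prop)
    (K : set (presented R)) :
    subgroup_set K -> (forall x, K (pres_class R (letter x))) ->
  forall g, K g.
Proof.
move=> sK Kx g; rewrite -[g]pres_reprK; elim: (pres_repr g) => [|[x e] w IHw].
  exact: sK.1.
have -> : pres_class R ((x, e) :: w) = pres_class R [:: (x, e)] * pres_class R w.
  exact: (pres_classM R [:: (x, e)] w).
apply: subgroup_setM => //; case: e {IHw}; last exact: Kx.
have -> : pres_class R [:: (x, true)] = (pres_class R (letter x))^-1.
  exact: (pres_classV R (letter x)).
exact: subgroup_setV.
Qed.

Local Notation G := one_relator_group.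

(** A named copy of the relation inside [one_relator_group], convertible to it. *)
Definition base_rel (l r : word bool) : Prop :=
  l = gen_a ^ (gen_b ^+ 2) /\ r = gen_a * (gen_a ^+ 3) ^ gen_b.

Definition ga : G := pres_class base_rel gen_a.
Definition gb : G := pres_class base_rel gen_b.

Lemma one_relator_gen (K : set G) :
  subgroup_set K -> K ga -> K gb -> forall g, K g.
Proof. by move=> sK Ka Kb; apply: pres_gen => // -[]. Qed.

Lemma one_relator_rel : ga ^ (gb ^+ 2) = ga * (ga ^+ 3) ^ gb.
Proof.
pose c := pres_class base_rel.
have cM u v : c (u * v) = (c u : G) * c v by exact: pres_classM.
have cV u : c u^-1 = (c u : G)^-1 by exact: pres_classV.
have -> : ga ^ (gb ^+ 2) = c (gen_a ^ (gen_b ^+ 2)).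
  (* Words obey no group laws, so powers are unfolded by conversion before [c] is distributed over
     products. *)
  rewrite -[gen_b ^+ 2]/(gen_b * gen_b) -[gb ^+ 2]/(gb * gb).
  by rewrite /conjg !(cM, cV).
have -> : ga * (ga ^+ 3) ^ gb = c (gen_a * (gen_a ^+ 3) ^ gen_b).
  rewrite -[gen_a ^+ 3]/(gen_a * (gen_a * gen_a)) -[ga ^+ 3]/(ga * (ga * ga)).
  by rewrite /conjg !(cM, cV).
apply/pres_classP.
exact: (@wc_rel _ base_rel 1 1 (gen_a ^ (gen_b ^+ 2))
  (gen_a * (gen_a ^+ 3) ^ gen_b)).
Qed.

Section OneRelatorAction.
Variables (T : Type) (A A' B B' : T -> T).
Hypotheses (AK : cancel A A') (A'K : cancel A' A).
Hypotheses (BK : cancel B B') (B'K : cancel B' B).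
Hypothesis relAB : forall t, B' (B' (A (B (B t)))) = A (B' (A (A (A (B t))))).

Definition gen_act (l : bool * bool) : T -> T :=
  match l with
  | (false, false) => A | (false, true) => A'
  | (true, false) => B | (true, true) => B'
  end.

Definition one_relator_act (g : G) : T -> T := @pres_act _ base_rel _ gen_act g.

Let gen_actK x e t : gen_act (x, e) (gen_act (x, ~~ e) t) = t.
Proof. by case: x e => -[] /=. Qed.

Let gen_actR l r : base_rel l r -> word_act gen_act l =1 word_act gen_act r.
Proof. by move=> [-> ->] t; apply: relAB. Qed.

Lemma one_relator_actM g h t :
  one_relator_act (g * h) t = one_relator_act g (one_relator_act h t).
Proof. exact: pres_actM. Qed.

Lemma one_relator_act1 t : one_relator_act 1 t = t.
Proof. exact: pres_act1. Qed.

Lemma one_relator_actK g t : one_relator_act g^-1 (one_relator_act g t) = t.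
Proof. exact: pres_actK. Qed.

Lemma one_relator_act_a t : one_relator_act ga t = A t.
Proof. exact: (pres_act_class gen_actK gen_actR gen_a). Qed.

Lemma one_relator_act_b t : one_relator_act gb t = B t.
Proof. exact: (pres_act_class gen_actK gen_actR gen_b). Qed.

Lemma one_relator_act_aV t : one_relator_act ga^-1 t = A' t.
Proof. by rewrite -{1}[t]A'K -one_relator_act_a one_relator_actK. Qed.

Lemma one_relator_act_bV t : one_relator_act gb^-1 t = B' t.
Proof. by rewrite -{1}[t]B'K -one_relator_act_b one_relator_actK. Qed.

End OneRelatorAction.

(* A point [(p, q, h)] records values [p], [q] of the free generators [a] and
   [a ^ b] of the fiber; [b] replaces them by the values of their conjugates. *)
Section PairModel.
Variable H : groupType.
Implicit Types (t : H * H * H) (p q v : H) (g : G).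

Let A t := (t.1, t.1.1 * t.2).
Let A' t := (t.1, t.1.1^-1 * t.2).
Let B t := ((t.1.2, t.1.1 * t.1.2 ^+ 3), t.2).
Let B' t := ((t.1.2 / t.1.1 ^+ 3, t.1.1), t.2).

Let AK : cancel A A'. Proof. by move=> [[p q] h]; rewrite /A' /= mulKg. Qed.
Let A'K : cancel A' A. Proof. by move=> [[p q] h]; rewrite /A /= mulVKg. Qed.
Let BK : cancel B B'. Proof. by move=> [[p q] h]; rewrite /B' /= mulgK. Qed.
Let B'K : cancel B' B. Proof. by move=> [[p q] h]; rewrite /B /= mulgVK. Qed.

Let relAB t : B' (B' (A (B (B t)))) = A (B' (A (A (A (B t))))).
Proof.
by case: t => [[p q] h]; rewrite /A /B' /= !mulgK !expgS expg0 mulg1 !mulgA.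
Qed.

Let act := one_relator_act A A' B B'.

(** Substituting [p] and [q] for the free generators of the fiber turns [g] into [v]; no word for
    [g] has to be chosen. *)
Definition evaluates p q g v := forall h, act g (p, q, h) = (p, q, v * h).

Lemma evaluatesM p q g g' v v' :
  evaluates p q g v -> evaluates p q g' v' -> evaluates p q (g * g') (v * v').
Proof.
by move=> gv gv' h; rewrite /act one_relator_actM // -/act gv' gv mulgA.
Qed.

Lemma evaluatesV p q g v : evaluates p q g v -> evaluates p q g^-1 v^-1.
Proof.
by move=> gv h; rewrite -{1}[h](mulVKg v) -gv /act one_relator_actK.
Qed.

Lemma evaluatesR p q g g' v v' :
    evaluates p q g v -> evaluates p q g' v' ->
  evaluates p q [~ g, g'] [~ v, v'].
Proof.
move=> gv gv'; rewrite /commg /conjg.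
by do !apply: evaluatesM => //; apply: evaluatesV.
Qed.

Lemma evaluates_a p q : evaluates p q ga p.
Proof. by move=> h; rewrite /act one_relator_act_a. Qed.

Lemma evaluates_ab p q : evaluates p q (ga ^ gb) q.
Proof.
move=> h; rewrite /conjg /act !one_relator_actM // one_relator_act_bV //.
by rewrite one_relator_act_a // one_relator_act_b // /A /B' /= mulgK.
Qed.

Lemma evaluates1 p q v : evaluates p q 1 v -> v = 1.
Proof.
by move=> /(_ 1); rewrite /act one_relator_act1 // mulg1 => -[].
Qed.

End PairModel.

(* The seed and the step are chosen so that some evaluation in the symmetric
   group on five points sends every term of the sequence to the same 3-cycle. *)
Definition comm_seed : G := [~ ga, ga ^ gb].
Definition comm_step : G := [~ ga * ga ^ gb, (ga ^ gb) ^+ 2].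
Definition comm_seq n : G := iter n (fun g => [~ g, comm_step]) comm_seed.

(** The second hypothesis makes [[~ p, q]] a fixed point of the recursion evaluated at [p] and
    [q]. *)
Lemma comm_seq_neq1_of (H : groupType) (p q : H) :
    [~ p, q] != 1 -> [~ [~ p, q], [~ p * q, q ^+ 2]] = [~ p, q] ->
  forall n, comm_seq n <> 1.
Proof.
move=> pq1 pqE n.
have a_p := evaluates_a p q; have b_q := evaluates_ab p q.
have: evaluates p q (comm_seq n) [~ p, q].
  elim: n => [|n IHn]; first exact: evaluatesR.
  rewrite -pqE; apply: evaluatesR => //.
  by rewrite /comm_step !expg2; apply: evaluatesR; apply: evaluatesM.
by move=> + c1; rewrite c1 => /evaluates1/eqP; rewrite (negbTE pq1).
Qed.

Lemma comm_seq_neq1 n : comm_seq n <> 1.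
Proof.
(* [p] swaps 3 and 4, and [q] is the 5-cycle [i |-> i + 1], so [c = [~ p, q]] is a 3-cycle on 0, 3,
   4. The value [s] of [comm_step] conjugates [c] to its inverse [c ^+ 2], whence [[~ c, s] = c^-1 *
   c ^ s = c]. *)
pose f (i : 'I_5) : 'I_5 :=
  if val i == 3%N then Ordinal (isT : 4 < 5)%N else
  if val i == 4%N then Ordinal (isT : 3 < 5)%N else i.
have fK : involutive f.
  by case=> [[|[|[|[|[|//]]]]] lti]; apply/val_inj.
pose p : {perm 'I_5} := perm (inv_inj fK).
pose q : {perm 'I_5} := perm (can_inj (@ordSK 5)).
pose q' : {perm 'I_5} := perm (can_inj (@ord_predK 5)).
have pV : p^-1 = p by apply/mulg1_eq/permP => i; rewrite permM !permE fK.
have qV : q^-1 = q' by apply/mulg1_eq/permP => i; rewrite permM !permE ordSK.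
have pqE : [~ p, q] = p * (q' * (p * q)) by rewrite /commg /conjg pV qV.
apply: (@comm_seq_neq1_of _ p q).
  by apply/eqP => /permP/(_ ord0)/(congr1 val); rewrite pqE !permM !permE.
apply/permP => i; apply/val_inj.
rewrite pqE /commg /conjg expg2 !invgM -!qV !invgK !(qV, pV) !permM !permE.
by case: i => [[|[|[|[|[|//]]]]] lti].
Qed.

Import GRing.Theory Num.Theory.
Local Open Scope ring_scope.

(** * The ring [Z[lambda]] *)

Definition qint : Type := (int * int)%type.
HB.instance Definition _ := GRing.Zmodule.copy qint (int * int)%type.

(* [(x, y)] stands for [x + y * lambda], where [lambda ^ 2 = 1 + 3 lambda]. *)
Definition qmul (u v : qint) : qint :=
  (u.1 * v.1 + u.2 * v.2, u.1 * v.2 + u.2 * v.1 + 3 * u.2 * v.2).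

Fact qmulA : associative qmul.
Proof. by move=> [a b] [c d] [e f]; congr pair => /=; ring. Qed.
Fact qmulC : commutative qmul.
Proof. by move=> [a b] [c d]; congr pair => /=; ring. Qed.
Fact qmul1 : left_id ((1, 0) : qint) qmul.
Proof. by move=> [a b]; congr pair => /=; ring. Qed.
Fact qmulDl : left_distributive qmul +%R.
Proof. by move=> [a b] [c d] [e f]; congr pair => /=; ring. Qed.
Fact qint_neq0 : ((1, 0) : qint) != 0.
Proof. by []. Qed.

HB.instance Definition _ := GRing.Zmodule_isComNzRing.Build qint
  qmulA qmulC qmul1 qmulDl qint_neq0.

Lemma qint_intr (z : int) : z%:~R = (z, 0) :> qint.
Proof.
have natE n : n%:R = (n%:Z, 0) :> qint.
  by elim: n => [//|n IHn]; rewrite mulrS IHn; congr pair => /=; lia.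
case: z => n; first exact: natE.
by rewrite NegzE mulrNz; apply: (congr1 -%R (natE n.+1)).
Qed.

(** The product of [x + y lambda] with its conjugate under [lambda |-> 3 - lambda]. *)
Definition qnorm (u : qint) : int := u.1 ^+ 2 + 3 * u.1 * u.2 - u.2 ^+ 2.

Lemma qnormM u v : qnorm (u * v) = qnorm u * qnorm v.
Proof. by case: u v => [a b] [c d]; rewrite /qnorm /=; ring. Qed.

Lemma qnormX u n : qnorm (u ^+ n) = qnorm u ^+ n.
Proof. by elim: n => [//|n IHn]; rewrite !exprS qnormM IHn. Qed.

(** Infinite descent: the form is anisotropic modulo 2, so a zero has even coordinates and can be
    halved. *)
Lemma qnorm_eq0 u : qnorm u = 0 -> u = 0.
Proof.
suff desc n a b : (`|a| + `|b| < n)%N -> qnorm (a, b) = 0 -> a = 0 /\ b = 0.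
  by case: u => a b /(desc _ a b (ltnSn _))[-> ->].
elim: n a b => [//|n IHn] a b; rewrite /qnorm !expr2 /= => lt_n ab0.
have halve (z : int) : exists c : int, z = 2 * c \/ z = 2 * c + 1.
  by exists (z %/ 2)%Z; lia.
have [[c ac] [d bd]] := (halve a, halve b).
have [ac2 bd2] : a = 2 * c /\ b = 2 * d.
  by case: ac bd lt_n ab0 => -> [] -> _ ab0; split; lia.
have [/eqP n0|n0] := boolP (n == 0%N); first by lia.
by have [||c0 d0] := IHn c d; rewrite ?/qnorm ?expr2 /=; lia.
Qed.

Definition eigen (c : bool) : qint := if c then (0, 1) else (3, -1).
Definition eigenw (w : seq bool) : qint := \prod_(c <- w) eigen c.

Lemma eigen_sqr c : eigen c ^+ 2 = 1 + eigen c *+ 3.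
Proof. by case: c. Qed.

Lemma eigenw_unit w : exists u, u * eigenw w = 1.
Proof.
elim: w => [|c w [u uw]]; first by exists 1; rewrite /eigenw big_nil mulr1.
(* The inverse of [eigen c] is [- eigen (~~ c)], because [lambda mu = -1]. *)
exists (- eigen (~~ c) * u); rewrite /eigenw big_cons -/(eigenw w).
rewrite mulrACA uw mulr1; by case: c.
Qed.

(** Multiplication by either eigenvalue exchanges the two patterns. The modulus 9, rather than 3,
    separates the norms congruent to 4 from 1. *)
Lemma eigenw_mod9 w : exists e x y : int, [/\ e = 1 \/ e = -1 &
  eigenw w = (e + 9 * x, 3 * y) \/ eigenw w = (3 * y, e + 9 * x)].
Proof.
elim: w => [|c w [e [x [y [e1 wE]]]]].
  exists 1, 0, 0; rewrite /eigenw big_nil; split; by left.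
rewrite /eigenw big_cons -/(eigenw w); case: c; case: wE => ->.
- by exists e, (x + y), y; split=> //; right; congr pair => /=; ring.
- by exists e, x, (y + e + 9 * x); split=> //; left; congr pair => /=; ring.
- exists (- e), (- x), (e + 9 * x - y); split; last right; first lia.
  by congr pair => /=; ring.
- exists (- e), (y - x), (- y); split; last left; first lia.
  by congr pair => /=; ring.
Qed.

(** By [eigenw_mod9] this norm is divisible by 3 or congruent to 4 modulo 9. *)
Lemma qnorm_eigenw w : qnorm (eigenw w - 1) != 1 /\ qnorm (eigenw w - 1) != -1.
Proof.
have [e [x [y [e1 wE]]]] := eigenw_mod9 w.
by case: wE e1 => -> [] ->; rewrite /qnorm /=; lia.
Qed.

Lemma eigenw_divisible_eq0 w (u : qint) :
  (forall n, exists v, u = (eigenw w - 1) ^+ n * v) -> u = 0.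
Proof.
move=> div_u; apply: qnorm_eq0; apply/eqP; apply/negPn/negP => u0.
have [d1 dN1] := qnorm_eigenw w; set d := qnorm _ in d1 dN1.
have dvd n : (d ^+ n %| qnorm u)%Z.
  have [v ->] := div_u n.
  by rewrite qnormM qnormX dvdz_mulr.
have d_gt1 : (1 < `|d|)%N.
  (* The case [d = 0] does occur, when [eigenw w = 1]; then divisibility by [d] alone contradicts
     [u0]. *)
  have d0 : d != 0 by apply: contraNneq u0 => d0; have := dvd 1; rewrite d0 dvd0z.
  by move: d0 d1 dN1; lia.
have := dvdn_leq _ (dvd `|qnorm u|%N); rewrite absz_gt0 abszX => /(_ u0).
by rewrite leqNgt ltn_expl.
Qed.

(** * Power series *)

(* Noncommutative power series over Z: [p w] is the coefficient of the
   monomial [w], where [false] is the variable X and [true] the variable Y. *)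
Definition series : Type := seq bool -> int.
HB.instance Definition _ := GRing.Zmodule.copy series (seq bool -> int).
Implicit Types (p q r : series) (w : seq bool) (c d : bool).

Definition lder c p : series := fun w => p (c :: w).

Lemma seriesP p q :
  p [::] = q [::] -> (forall c, lder c p = lder c q) -> p = q.
Proof.
by move=> pq0 pq; apply/funext => -[//|c w]; apply: (congr1 (@^~ w) (pq c)).
Qed.

Lemma lderB c p q : lder c (p - q) = lder c p - lder c q. Proof. by []. Qed.

(** The series has no monomial of degree below [n]; the recursion follows left derivatives, as the
    operators below do. *)
Fixpoint vanish n p : Prop :=
  if n is n'.+1 then p [::] = 0 /\ forall c, vanish n' (lder c p) else True.

Lemma vanishS n p : vanish n.+1 p -> vanish n p.
Proof.
by elim: n p => [//|n IHn] p [p0 pn]; split=> // c; apply: IHn; apply: pn.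
Qed.

Lemma vanish_le m n p : (m <= n)%N -> vanish n p -> vanish m p.
Proof.
move=> /subnK <-; elim: (n - m)%N => [|k IHk]; first by rewrite add0n.
by rewrite addSn => /vanishS.
Qed.

Lemma vanishB n p q : vanish n p -> vanish n q -> vanish n (p - q).
Proof.
elim: n p q => [//|n IHn] p q [p0 pn] [q0 qn]; split=> [|c].
  by rewrite -[LHS]/(p [::] - q [::]) p0 q0.
by apply: IHn; [apply: pn|apply: qn].
Qed.

Lemma vanish0 n : vanish n 0.
Proof. by elim: n. Qed.

Lemma vanishN n p : vanish n p -> vanish n (- p).
Proof. by move=> pn; rewrite -sub0r; apply: vanishB => //; apply: vanish0. Qed.

Lemma vanishD n p q : vanish n p -> vanish n q -> vanish n (p + q).
Proof. by move=> pn qn; rewrite -[q]opprK; apply: vanishB => //; apply: vanishN. Qed.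

Lemma vanish_eq0 p : (forall n, vanish n p) -> p = 0.
Proof.
move=> p0; apply/funext => w.
elim: w p p0 => [|c w IHw] p p0; first by case: (p0 1%N).
by apply: (IHw (lder c p)) => n; case: (p0 n.+1) => _; apply.
Qed.

Definition sub_morph (f : series -> series) := forall p q, f (p - q) = f p - f q.

Section Additive.
Variables (f : series -> series) (fB : sub_morph f).

Lemma sub_morph0 : f 0 = 0.
Proof. by have := fB 0 0; rewrite !subrr. Qed.

Lemma sub_morphN p : f (- p) = - f p.
Proof. by rewrite -sub0r fB sub_morph0 sub0r. Qed.

Lemma sub_morphD p q : f (p + q) = f p + f q.
Proof. by rewrite -{1}[q]opprK fB sub_morphN opprK. Qed.

End Additive.

(* Left multiplication by [1 + c] for a variable [c]. *)
Definition lmul c p : series :=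
  fun w => if w is d :: w' then p w + (if d == c then p w' else 0) else p [::].

(** The solution [q] of [q + c q = p], by recursion on the monomial. *)
Fixpoint lmulV_coef c p w : int :=
  p w - (if w is d :: w' then if d == c then lmulV_coef c p w' else 0 else 0).
Definition lmulV c p : series := lmulV_coef c p.

Lemma lmul_nil c p : lmul c p [::] = p [::]. Proof. by []. Qed.

Lemma lder_lmul c d p : lder d (lmul c p) = lder d p + (if d == c then p else 0).
Proof. by apply/funext => w; rewrite /lder /lmul !fctE; case: ifP. Qed.

Lemma lmulV_nil c p : lmulV c p [::] = p [::]. Proof. exact: subr0. Qed.

Lemma lder_lmulV c d p :
  lder d (lmulV c p) = lder d p - (if d == c then lmulV c p else 0).
Proof. by apply/funext => w; rewrite /lder /lmulV /= !fctE; case: ifP. Qed.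

Lemma lmulB c : sub_morph (lmul c).
Proof.
move=> p q; apply/funext => -[|d w]; rewrite /lmul !fctE /=; first by [].
by case: ifP => _; ring.
Qed.

Lemma lmulKV c : cancel (lmulV c) (lmul c).
Proof.
move=> p; apply: seriesP => [|d]; first by rewrite lmul_nil lmulV_nil.
by rewrite lder_lmul lder_lmulV subrK.
Qed.

Lemma lmulK c : cancel (lmul c) (lmulV c).
Proof.
move=> p; apply/funext; elim => [|d w IHw]; first by rewrite lmulV_nil lmul_nil.
have := congr1 (@^~ w) (lder_lmulV c d (lmul c p)); rewrite {1}/lder => ->.
rewrite lder_lmul; move: IHw; case: ifP => _ IHw;
  rewrite !fctE /= ?IHw ?addr0 ?subr0 //.
by rewrite addrK.
Qed.

Lemma lmulVB c : sub_morph (lmulV c).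
Proof. by move=> p q; apply: (can_inj (lmulK c)); rewrite lmulB !lmulKV. Qed.

Lemma lmul_vanish n c p : vanish n p -> vanish n (lmul c p).
Proof.
elim: n p => [//|n IHn] p [p0 pn]; split=> [|d]; first by rewrite lmul_nil.
rewrite lder_lmul; apply: vanishD; first exact: pn.
case: ifP => _; last exact: vanish0.
by apply: vanishS; exact: conj p0 pn.
Qed.

Lemma lmulV_vanish n c p : vanish n p -> vanish n (lmulV c p).
Proof.
elim: n p => [//|n IHn] p pn; split=> [|d].
  by rewrite lmulV_nil; have [] := pn.
rewrite lder_lmulV; apply: vanishB; first by case: pn => _; apply.
case: ifP => _; last exact: vanish0.
by apply: IHn; apply: vanishS.
Qed.

Lemma lmul_sub_vanish n c p : vanish n p -> vanish n.+1 (lmul c p - p).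
Proof.
move=> pn; split=> [|d]; first by rewrite !fctE lmul_nil subrr.
rewrite lderB lder_lmul addrAC subrr add0r.
by case: ifP => _ //; exact: vanish0.
Qed.

(** * The automorphism of the power series ring and its eigencovectors *)

Local Notation A := (lmul false).
Local Notation A' := (lmulV false).
Local Notation B := (lmul true).
Local Notation B' := (lmulV true).

(* The substitution [X |-> Y], [Y |-> (1 + X) (1 + Y) ^ 3 - 1]. Since it turns
   [1 + X] into [1 + Y], the factor [(1 + Y) ^ 3] on the left of its value can
   be absorbed into its argument as [(1 + X) ^ 3], which makes the recursion on
   the monomial structural. *)
Fixpoint subst_coef w p : int :=
  match w with
  | [::] => p [::]
  | false :: w' => subst_coef w' (A (A (A (lder true p))))
  | true :: w' => subst_coef w' (lder false p +
       (lder true p + A (lder true p) + A (A (lder true p))))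
  end.
Definition subst p : series := fun w => subst_coef w p.

(** The inverse substitution [Y |-> X], [X |-> (1 + Y) (1 + X) ^ -3 - 1]. The three-term sum comes
    from [1 - t ^ -3 = (t - 1) (t ^ -1 + t ^ -2 + t ^ -3)] at [t = 1 + X]. *)
Fixpoint substV_coef w p : int :=
  match w with
  | [::] => p [::]
  | true :: w' => substV_coef w' (B' (B' (B' (lder false p))))
  | false :: w' => substV_coef w' (lder true p -
       (B' (lder false p) + B' (B' (lder false p)) + B' (B' (B' (lder false p)))))
  end.
Definition substV p : series := fun w => substV_coef w p.

Lemma lder_substX p : lder false (subst p) = subst (A (A (A (lder true p)))).
Proof. by []. Qed.
Lemma lder_substY p : lder true (subst p) = subst (lder false p +
       (lder true p + A (lder true p) + A (A (lder true p)))).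
Proof. by []. Qed.
Lemma lder_substVX p : lder false (substV p) = substV (lder true p -
  (B' (lder false p) + B' (B' (lder false p)) + B' (B' (B' (lder false p))))).
Proof. by []. Qed.
Lemma lder_substVY p :
  lder true (substV p) = substV (B' (B' (B' (lder false p)))).
Proof. by []. Qed.

Local Ltac series_ring := by apply/funext => ?; rewrite !fctE; ring.

Lemma substB : sub_morph subst.
Proof.
suff coefB w p q : subst_coef w (p - q) = subst_coef w p - subst_coef w q.
  by move=> p q; apply/funext => w; apply: coefB.
elim: w p q => [//|[] w IHw] p q; rewrite /= -IHw; congr (subst_coef w).
  by rewrite !lderB !lmulB; series_ring.
by rewrite lderB !lmulB.
Qed.

Lemma substVB : sub_morph substV.
Proof.
suff coefB w p q : substV_coef w (p - q) = substV_coef w p - substV_coef w q.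
  by move=> p q; apply/funext => w; apply: coefB.
elim: w p q => [//|[] w IHw] p q; rewrite /= -IHw; congr (substV_coef w).
  by rewrite lderB !lmulVB.
by rewrite !lderB !lmulVB; series_ring.
Qed.

Lemma lmulD c p q : lmul c (p + q) = lmul c p + lmul c q.
Proof. exact: sub_morphD (lmulB c) p q. Qed.

Lemma substD p q : subst (p + q) = subst p + subst q.
Proof. exact: sub_morphD substB p q. Qed.

Lemma substVD p q : substV (p + q) = substV p + substV q.
Proof. exact: sub_morphD substVB p q. Qed.

(** With [subst_lmulY], this is the multiplicativity of the substitution that the relation of [G]
    calls for. *)
Lemma subst_lmulX p : subst (A p) = B (subst p).
Proof.
apply: seriesP => [//|[]]; rewrite lder_lmul /= ?addr0.
  rewrite !lder_substY !lder_lmul /= !addr0 -substD; congr subst.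
  by series_ring.
by rewrite !lder_substX !lder_lmul /= addr0.
Qed.

Lemma subst_lmulY p : subst (B p) = A (B (B (B (subst p)))).
Proof.
rewrite -!subst_lmulX; apply: seriesP => [|[]].
- by [].
- rewrite lder_lmul /= addr0.
  rewrite !lder_substY !lder_lmul /= !addr0 !lmulD; congr subst.
  by series_ring.
- by rewrite lder_lmul /= !lder_substX !lder_lmul /= !addr0 !lmulD -substD.
Qed.

Lemma substK : cancel subst substV.
Proof.
move=> p; apply/funext => w; rewrite /substV.
elim: w p => [//|[] w IHw] p /=; rewrite ?lder_substX ?lder_substY !subst_lmulX !lmulK.
  exact: IHw.
rewrite !substD !subst_lmulX.
rewrite [X in substV_coef w X](_ : _ = subst (lder false p)); last by series_ring.
exact: IHw.
Qed.

Lemma substV_lmulY p : substV (B p) = A (substV p).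
Proof.
apply: seriesP => [|[]]; last 2 first; rewrite 1?lder_lmul /= ?addr0.
- by rewrite !lder_substVY !lder_lmul /= addr0.
- rewrite !lder_substVX !lder_lmul /= !addr0 -substVD; congr substV.
  by series_ring.
- by [].
Qed.

Lemma substVK : cancel substV subst.
Proof.
move=> p; apply/funext => w; rewrite /subst.
elim: w p => [//|[] w IHw] p /=; rewrite lder_substVY -?substV_lmulY !lmulKV.
  rewrite lder_substVX -!substVD.
  rewrite [X in substV X](_ : _ = lder true p); last by series_ring.
  exact: IHw.
exact: IHw.
Qed.

Lemma subst_vanish n p : vanish n p -> vanish n (subst p).
Proof.
elim: n p => [//|n IHn] p [p0 pn]; split=> // -[].
  rewrite lder_substY; apply: IHn.
  by do ?[apply: pn | apply: lmul_vanish | apply: vanishD].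
by rewrite lder_substX; apply: IHn; do 3!apply: lmul_vanish; apply: pn.
Qed.

Lemma substV_vanish n p : vanish n p -> vanish n (substV p).
Proof.
elim: n p => [//|n IHn] p [p0 pn]; split=> // -[].
  by rewrite lder_substVY; apply: IHn; do 3!apply: lmulV_vanish; apply: pn.
rewrite lder_substVX; apply: IHn.
by do ?[apply: pn | apply: lmulV_vanish | apply: vanishB | apply: vanishD].
Qed.

(* On the homogeneous component of degree [size w], the tensor product of the
   eigencovectors [X |-> 1, Y |-> eigen c] for [c] in [w]. *)
Fixpoint covector w p : qint :=
  if w is c :: w' then covector w' (lder false p) + eigen c * covector w' (lder true p)
  else (p [::])%:~R.

Lemma covectorB w p q : covector w (p - q) = covector w p - covector w q.
Proof.
elim: w p q => [|c w IHw] p q /=; first exact: intrB.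
by rewrite !lderB !IHw; ring.
Qed.

Lemma covector0 w : covector w 0 = 0.
Proof. by have := covectorB w 0 0; rewrite !subrr. Qed.

Lemma covectorD w p q : covector w (p + q) = covector w p + covector w q.
Proof.
by rewrite -{1}[q]opprK -[- q]sub0r !covectorB covector0; ring.
Qed.

Lemma covector_vanish w p : vanish (size w).+1 p -> covector w p = 0.
Proof.
elim: w p => [|c w IHw] p [p0 pn] /=; first by rewrite p0.
by rewrite !IHw ?mulr0 ?addr0 //; apply: pn.
Qed.

(** The covectors of length [n] separate the homogeneous component of degree [n] because the two
    eigenvalues differ. *)
Lemma covector_eq0 n p :
    (forall w, size w = n -> covector w p = 0) -> vanish n p -> vanish n.+1 p.
Proof.
elim: n p => [|n IHn] p p0 pn.
  by split=> //; have := p0 [::] erefl => /=; rewrite qint_intr => -[].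
have [p1 pn'] := pn; split=> // c.
have p_eq d w : size w = n ->
    covector w (lder false p) + eigen d * covector w (lder true p) = 0.
  by move=> wn; apply: (p0 (d :: w)); rewrite /= wn.
have Y0 w : size w = n -> covector w (lder true p) = 0.
  move=> wn; apply: qnorm_eq0.
  (* Subtracting the conditions for the two eigenvalues isolates the [Y] derivative; the norm of
     their difference is -13. *)
  have: (eigen true - eigen false) * covector w (lder true p) = 0.
    by have := p_eq true w wn; rewrite -{1}(p_eq false w wn) => /addrI/eqP;
      rewrite -subr_eq0 -mulrBl => /eqP.
  move=> /(congr1 qnorm)/eqP; rewrite qnormM mulf_eq0 => /orP[|/eqP->//].
  by rewrite /qnorm.
apply: IHn; last exact: pn'.
move=> w wn; case: c; first exact: Y0.
by have := p_eq true w wn; rewrite Y0 // mulr0 addr0.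
Qed.

Lemma covector_lmul w c p :
  vanish (size w) p -> covector w (lmul c p) = covector w p.
Proof.
move=> pw; apply/subr0_eq; rewrite -covectorB; apply: covector_vanish.
exact: lmul_sub_vanish.
Qed.

(** In lowest degree left multiplication by [1 + X] is invisible and the substitution is linear,
    [X |-> Y] and [Y |-> X + 3 Y]; [eigen_sqr] is then the eigenvector equation. *)
Lemma covector_subst w p :
  vanish (size w) p -> covector w (subst p) = eigenw w * covector w p.
Proof.
elim: w p => [|c w IHw] p; first by rewrite /eigenw big_nil mul1r.
move=> [p0 pn] /=; rewrite lder_substX lder_substY.
have pX : vanish (size w) (lder false p) := pn false.
have pY : vanish (size w) (lder true p) := pn true.
have vA q : vanish (size w) q -> vanish (size w) (A q) by apply: lmul_vanish.
have vD := @vanishD (size w).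
rewrite !IHw; [|by auto 10|by auto].
rewrite !covectorD !covector_lmul //; [|by auto..].
rewrite /eigenw big_cons -/(eigenw w).
have := eigen_sqr c.
move: (eigen c) (eigenw w) (covector w _) (covector w _) => l m x y l2.
by transitivity (m * (l * x + (1 + l *+ 3) * y)); [ring|rewrite -l2; ring].
Qed.

(** * The dimension subgroups *)

Section Convolution.
(** The product of power series. It serves to show that an element of the fiber acts as left
    multiplication by its value on [series1]. *)
Fixpoint conv_coef w q p : int :=
  if w is c :: w' then q [::] * p w + conv_coef w' (lder c q) p
  else q [::] * p [::].
Definition conv q p : series := fun w => conv_coef w q p.

Lemma lder_conv c q p w :
  lder c (conv q p) w = q [::] * lder c p w + conv (lder c q) p w.
Proof. by []. Qed.

Lemma convB q r p : conv (q - r) p = conv q p - conv r p.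
Proof.
apply/funext => w; rewrite !fctE /conv.
elim: w q r => [|c w IHw] q r /=; rewrite ?lderB ?IHw ?fctE; ring.
Qed.

Lemma conv0 p : conv 0 p = 0.
Proof. by have := convB 0 0 p; rewrite !subrr. Qed.

Lemma convD q r p : conv (q + r) p = conv q p + conv r p.
Proof. by rewrite -{1}[r]opprK -[- r]sub0r !convB conv0 sub0r opprK. Qed.

Definition series1 : series := fun w => if w is [::] then 1 else 0.

Lemma conv1 p : conv series1 p = p.
Proof.
apply: seriesP => [|c]; first by rewrite /conv /= mul1r.
have -> : lder c (conv series1 p) = lder c p + conv 0 p.
  by apply/funext => w; rewrite !fctE lder_conv mul1r.
by rewrite conv0 addr0.
Qed.

Lemma conv_vanish m n q p : vanish m q -> vanish n p -> vanish (m + n) (conv q p).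
Proof.
have convE c r s : lder c (conv r s) =
    (fun w => r [::] * lder c s w) + conv (lder c r) s by [].
have vZ k (z : int) s : vanish k s -> vanish k (fun w => z * s w).
  elim: k s => [//|k IHk] s [s0 sk]; split; first by rewrite s0 mulr0.
  by move=> c; apply: (IHk (lder c s)); apply: sk.
elim: m q => [|m IHm] q qm.
  elim: n p q {qm} => [//|n IHn] p q pn.
  split=> [|c]; first by case: pn => p0 _; rewrite /conv /= p0 mulr0.
  rewrite convE; apply: vanishD; first by apply: vZ; case: pn => _; apply.
  by apply: IHn; apply: vanishS.
move=> pn; case: qm => q0 qm; rewrite addSn; split=> [|c].
  by rewrite /conv /= q0 mul0r.
rewrite convE; apply: vanishD; last by apply: IHm => //; apply: qm.
rewrite (_ : (fun w => _) = 0); first exact: vanish0.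
by apply/funext => w; rewrite q0 mul0r.
Qed.

Lemma lmul_conv c q p : lmul c (conv q p) = conv (lmul c q) p.
Proof.
apply: seriesP => [//|d]; rewrite lder_lmul.
apply/funext => w; rewrite fctE !lder_conv lder_lmul convD fctE addrA.
by case: ifP => _; rewrite ?conv0.
Qed.
End Convolution.

(** * The action of [G] on power series and the dimension filtration *)

Section SeriesAction.
Implicit Types (g h : G) (n : nat).
Local Open Scope group_scope.

(** [gb] acts by the inverse substitution, so that [ga ^ gb] acts as left multiplication by
    [1 + Y]. *)
Definition sact : G -> series -> series :=
  one_relator_act (lmul false) (lmulV false) substV subst.

Let relAB p :
  subst (subst (lmul false (substV (substV p)))) =
  lmul false (subst (lmul false (lmul false (lmul false (substV p))))).
Proof. by rewrite subst_lmulX subst_lmulY substVK !subst_lmulX substVK. Qed.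

Let lXK := @lmulK false.
Let lXVK := @lmulKV false.

Lemma sactM g h p : sact (g * h) p = sact g (sact h p).
Proof. exact: (one_relator_actM lXK lXVK substVK substK relAB). Qed.

Lemma sact1 p : sact 1 p = p.
Proof. exact: (one_relator_act1 lXK lXVK substVK substK relAB). Qed.

Lemma sactK g p : sact g^-1 (sact g p) = p.
Proof. by rewrite -sactM mulVg sact1. Qed.

Lemma sactVK g p : sact g (sact g^-1 p) = p.
Proof. by rewrite -sactM mulgV sact1. Qed.

Lemma sact_a p : sact ga p = lmul false p.
Proof. exact: (one_relator_act_a lXK lXVK substVK substK relAB). Qed.

Lemma sact_aV p : sact ga^-1 p = lmulV false p.
Proof. exact: (one_relator_act_aV lXK lXVK substVK substK relAB). Qed.

Lemma sact_b p : sact gb p = substV p.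
Proof. exact: (one_relator_act_b lXK lXVK substVK substK relAB). Qed.

Lemma sact_bV p : sact gb^-1 p = subst p.
Proof. exact: (one_relator_act_bV lXK lXVK substVK substK relAB). Qed.

Lemma sact_ab p : sact (ga ^ gb) p = lmul true p.
Proof. by rewrite /conjg !sactM sact_bV sact_a sact_b subst_lmulX substVK. Qed.

Lemma one_relator_ind (P : G -> Prop) :
    P 1 -> (forall g h, P g -> P h -> P (g * h)) ->
    P ga -> P ga^-1 -> P gb -> P gb^-1 ->
  forall g, P g.
Proof.
move=> P1 PM Pa PaV Pb PbV g.
suff [] : P g /\ P g^-1 by [].
apply: (@one_relator_gen [set g | P g /\ P g^-1]) => //.
apply: subgroup_setP => [|x y [Px PxV] [Py PyV]|x [Px PxV]] /=.
- by rewrite invg1.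
- by rewrite invgM; split; apply: PM.
- by rewrite invgK.
Qed.

Lemma sactB g p q : sact g (p - q) = (sact g p - sact g q)%R.
Proof.
elim/one_relator_ind: g p q => [|g h IHg IHh||||] p q.
- by rewrite !sact1.
- by rewrite !sactM IHh IHg.
- by rewrite !sact_a lmulB.
- by rewrite !sact_aV lmulVB.
- by rewrite !sact_b substVB.
- by rewrite !sact_bV substB.
Qed.

Lemma sact_vanish g n p : vanish n p -> vanish n (sact g p).
Proof.
elim/one_relator_ind: g p => [|g h IHg IHh||||] p pn.
- by rewrite sact1.
- by rewrite sactM; apply/IHg/IHh.
- by rewrite sact_a; apply: lmul_vanish.
- by rewrite sact_aV; apply: lmulV_vanish.
- by rewrite sact_b; apply: substV_vanish.
- by rewrite sact_bV; apply: subst_vanish.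
Qed.

Lemma sact_nil g p : sact g p [::] = p [::].
Proof.
elim/one_relator_ind: g p => [|g h IHg IHh||||] p.
- by rewrite sact1.
- by rewrite sactM IHg.
- by rewrite sact_a.
- by rewrite sact_aV lmulV_nil.
- by rewrite sact_b.
- by rewrite sact_bV.
Qed.

Lemma sact_sub_vanish1 g p : vanish 1 (sact g p - p)%R.
Proof. by split=> //; rewrite fctE sact_nil subrr. Qed.

(** In lowest degree [ga] acts trivially and [gb] by the inverse of [eigenw w], so all scalars are
    congruent to 1 modulo [eigenw w - 1]. *)
Lemma sact_covector g w : exists z : qint, forall p, vanish (size w) p ->
  covector w (sact g p) = ((1 + (eigenw w - 1) * z) * covector w p)%R.
Proof.
elim/one_relator_ind: g => [|g h [z IHg] [z' IHh]||||].
- by exists 0%R => p _; rewrite sact1; ring.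
- exists (z + z' + (eigenw w - 1) * z * z')%R => p pw.
  by rewrite sactM IHg ?IHh //; [ring|apply: sact_vanish].
- by exists 0%R => p pw; rewrite sact_a covector_lmul //; ring.
- exists 0%R => p pw; rewrite sact_aV -{2}[p](lmulKV false).
  by rewrite covector_lmul; [ring|apply: lmulV_vanish].
(* With [u l = 1], the scalar [1 - (l - 1) u] equals [u]. *)
- have [u uw] := eigenw_unit w; exists (- u)%R => p pw.
  rewrite sact_b -{2}[p]substVK covector_subst; last exact: substV_vanish.
  move: uw; move: (eigenw w) (covector w _) => l x ul.
  rewrite (_ : _ * _ = l * x - (l - 1) * (u * l) * x)%R; last by ring.
  by rewrite ul; ring.
- by exists 1%R => p pw; rewrite sact_bV covector_subst //; ring.
Qed.

Definition fib : set G := fiber ga gb.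

Lemma fib_subgroup : subgroup_set fib.
Proof. exact: fiber_subgroup. Qed.

Lemma fib_normal : normal_set fib.
Proof. exact: (fiber_normal one_relator_gen one_relator_rel). Qed.

Lemma sact_conv g q p : fib g -> sact g (conv q p) = conv (sact g q) p.
Proof.
pose K := [set g | forall q p, sact g (conv q p) = conv (sact g q) p].
suff FK : fib `<=` K by move=> /FK; apply.
apply: fiber_ind; last 2 first.
- by move=> q' p'; rewrite !sact_a lmul_conv.
- by move=> q' p'; rewrite !sact_ab lmul_conv.
apply: subgroup_setP => [q' p'|x y Kx Ky q' p'|x Kx q' p'].
- by rewrite !sact1.
- by rewrite !sactM Ky Kx.
- by rewrite -{1}[q'](sactVK x) -Kx sactK.
Qed.

(** The [n]-th dimension subgroup of the fiber, [sact g series1] being the Magnus expansion of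
    [g]. *)
Definition depth n : set G := [set g | fib g /\ vanish n (sact g series1 - series1)%R].

Lemma depth_sub g m n p : depth m g -> vanish n p -> vanish (m + n) (sact g p - p)%R.
Proof.
move=> [Fg gm] pn.
by rewrite -{1 2}[p]conv1 sact_conv // -convB; apply: conv_vanish.
Qed.

Lemma depth_subgroup n : subgroup_set (depth n).
Proof.
have sF := fib_subgroup.
apply: subgroup_setP => [|g h [Fg gn] [Fh hn]|g [Fg gn]].
- by split; [exact: sF.1|rewrite sact1 subrr; apply: vanish0].
- split; first exact: (subgroup_setM sF).
  have -> : (sact (g * h) series1 - series1 =
      sact g (sact h series1 - series1) + (sact g series1 - series1))%R.
    by rewrite sactM sactB addrA subrK.
  by apply: vanishD => //; apply: sact_vanish.
- split; first exact: (subgroup_setV sF).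
  have -> : (sact g^-1 series1 - series1 =
      - sact g^-1 (sact g series1 - series1))%R.
    by rewrite sactB sactK opprB.
  by apply/vanishN/sact_vanish.
Qed.

Definition leading w g : qint := covector w (sact g series1 - series1)%R.

(** In [g h - 1 = (g - 1) (h - 1) + (g - 1) + (h - 1)] the product has order at least twice
    [size w], which exceeds [size w]. *)
Lemma leadingM w g h : (0 < size w)%N -> depth (size w) g -> depth (size w) h ->
  leading w (g * h) = (leading w g + leading w h)%R.
Proof.
move=> w0 dg dh; rewrite /leading.
set q := (sact h series1 - series1)%R.
have -> : (sact (g * h) series1 - series1 =
    (sact g q - q) + (q + (sact g series1 - series1)))%R.
  by rewrite sactM /q sactB; apply/funext => v; rewrite !fctE; ring.
rewrite covectorD (covectorD w q) [X in (X + _)%R]covector_vanish.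
  by rewrite add0r addrC.
apply: (@vanish_le _ (size w + size w)); first by rewrite -addn1 leq_add2l.
by apply: depth_sub => //; case: dh.
Qed.

Lemma leadingV w g : (0 < size w)%N -> depth (size w) g ->
  leading w g^-1 = (- leading w g)%R.
Proof.
move=> w0 dg; apply/eqP; rewrite -addr_eq0 addrC -leadingM //; last first.
  exact: (subgroup_setV (@depth_subgroup _)).
by rewrite mulgV /leading sact1 subrr covector0.
Qed.

(** Since [h] moves [series1] by a series [r] of order at least 1, the error is the image under
    [h^-1] of [(g - 1) r], of order at least [n + 1]. *)
Lemma depth_conj n g h : depth n g -> depth n (g ^ h) /\
  vanish n.+1 (sact (g ^ h) series1 - series1 -
               sact h^-1 (sact g series1 - series1))%R.
Proof.
move=> dg; have [Fg gn] := dg.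
pose r := (sact h series1 - series1)%R.
have gr : vanish n.+1 (sact g r - r)%R.
  by rewrite -addn1; apply: depth_sub => //; apply: sact_sub_vanish1.
have ghE : (sact (g ^ h) series1 - series1 =
    sact h^-1 (sact g r - r) + sact h^-1 (sact g series1 - series1))%R.
  rewrite /conjg !sactM /r !sactB sactK.
  by apply/funext => v; rewrite !fctE; ring.
split; last by rewrite ghE addrK; apply: sact_vanish.
split; first exact: fib_normal.2.
rewrite ghE; apply: vanishD; apply: sact_vanish => //.
exact: vanishS.
Qed.

(** Conjugation by [h] scales the leading term as in [sact_covector]. The factor [z] does not depend
    on [g]. *)
Lemma leading_comm w : (0 < size w)%N -> forall h, exists z : qint, forall g,
  depth (size w) g -> leading w [~ g, h] = ((eigenw w - 1) * z * leading w g)%R.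
Proof.
move=> w0 h; have [z hz] := sact_covector h^-1 w; exists z => g dg.
have [dgh gh] := depth_conj h dg.
rewrite commgEl leadingM //; last exact: (subgroup_setV (@depth_subgroup _)).
rewrite leadingV //.
have -> : leading w (g ^ h) = covector w (sact h^-1 (sact g series1 - series1)%R).
  by apply/subr0_eq; rewrite -covectorB covector_vanish.
by rewrite hz /leading; [ring|case: dg].
Qed.

Lemma depth_normal n : normal_set (depth n).
Proof.
split; first exact: depth_subgroup.
by move=> g h dg; have [] := depth_conj h dg.
Qed.

Lemma gamma_leading n (H : set G) m : (0 < n)%N -> H `<=` depth n ->
  gamma H m `<=` [set g | depth n g /\ forall w, size w = n ->
     exists y, leading w g = ((eigenw w - 1) ^+ m * y)%R].
Proof.
move=> n0 Hn; have sD := depth_subgroup n.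
elim: m => [|m IHm].
  by move=> g Hg; split; [apply: Hn|move=> w _; exists (leading w g); rewrite mul1r].
apply: comm_subgroup_sub.
  apply: subgroup_setP => [|g h [dg eg] [dh eh]|g [dg eg]].
  - split; first exact: sD.1.
    by move=> w _; exists 0%R; rewrite /leading sact1 subrr covector0 mulr0.
  - split; first exact: (subgroup_setM sD).
    move=> w wn; have [[y gy] [y' hy]] := (eg w wn, eh w wn).
    exists (y + y')%R; rewrite -wn in n0 dg dh.
    by rewrite leadingM // gy hy mulrDr.
  - split; first exact: (subgroup_setV sD).
    move=> w wn; have [y gy] := eg w wn; exists (- y)%R.
    by rewrite -wn in n0 dg; rewrite leadingV // gy mulrN.
move=> g h /IHm[dg eg]; split; first exact: (normal_set_comm h (depth_normal n)).
move=> w wn; have [y gy] := eg w wn; rewrite -wn in n0 dg.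
have [z hz] := leading_comm n0 h.
by exists (z * y)%R; rewrite hz // gy exprS; ring.
Qed.

(** Each commutation contributes a factor [eigenw w - 1] to the leading terms, so after [omega] of
    them they all vanish by [eigenw_divisible_eq0]. *)
Lemma gamma_omega_depth n (H : set G) : (0 < n)%N -> H `<=` depth n ->
  gamma_omega H `<=` depth n.+1.
Proof.
move=> n0 Hn g Hg; have [Fg gn] := Hn g (Hg 0%N); split=> //.
apply: covector_eq0 => // w wn; apply: (@eigenw_divisible_eq0 w) => m.
by have [_ eg] := gamma_leading n0 Hn (Hg m); apply: eg.
Qed.

Lemma iter_gamma_omega_depth n : iter n.+1 (@gamma_omega G) [set: G] `<=` depth n.+1.
Proof.
elim: n => [|n IHn]; last exact: gamma_omega_depth.
move=> g /(_ 1%N) Gg; split; last exact: sact_sub_vanish1.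
exact: (gamma1_sub_fiber one_relator_gen one_relator_rel).
Qed.

(** * Faithfulness of the action on the fiber: Magnus' theorem *)

Definition fgen c : G := if c then ga ^ gb else ga.

Definition fpow c (e : int) : G :=
  match e with Posz k => fgen c ^+ k | Negz k => (fgen c)^-1 ^+ k.+1 end.

Lemma fpow_succ c e : fpow c (e + 1)%R = fgen c * fpow c e.
Proof.
case: e => [k|[|k]].
- have -> : (Posz k + 1 = Posz k.+1)%R by lia.
  exact: expgS.
- by rewrite /= expg1 mulgV.
- have -> : (Negz k.+1 + 1)%R = Negz k by lia.
  by rewrite /= (expgS _ k.+1) mulVKg.
Qed.

Lemma fpow_pred c e : fpow c (e - 1)%R = (fgen c)^-1 * fpow c e.
Proof. by apply: (mulgI (fgen c)); rewrite mulVKg -fpow_succ subrK. Qed.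

Lemma fpowD c e e' : fpow c (e + e')%R = fpow c e * fpow c e'.
Proof.
elim/int_rect: e => [|k IHk|k IHk].
- by rewrite add0r mul1g.
- have -> : (k.+1%:Z + e' = (k%:Z + e') + 1)%R by lia.
  have -> : (k.+1%:Z = k%:Z + 1)%R by lia.
  by rewrite !fpow_succ IHk mulgA.
- have -> : (- k.+1%:Z + e' = (- k%:Z + e') - 1)%R by lia.
  have -> : (- k.+1%:Z = - k%:Z - 1)%R by lia.
  by rewrite !fpow_pred IHk mulgA.
Qed.

(** As [w] does not start with [c], only the constant and linear terms of [(1 + c) ^ e]
    contribute. *)
Lemma sact_fpow c e p w : (if w is d :: _ then d != c else true) ->
  sact (fpow c e) p w = p w /\
  sact (fpow c e) p (c :: w) = (p (c :: w) + e * p w)%R.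
Proof.
have sgen q : sact (fgen c) q = lmul c q.
  by case: c; [exact: sact_ab|exact: sact_a].
have sgenV q : sact (fgen c)^-1 q = lmulV c q.
  by rewrite -{1}[q](lmulKV c) -sgen sactK.
move=> wc.
have lmul_w q : lmul c q w = q w by case: w wc => [//|d w] /= /negbTE->; rewrite addr0.
have lmulV_w q : lmulV c q w = q w by rewrite -{2}[q](lmulKV c) lmul_w.
elim/int_rect: e => [|k IHk|k IHk].
- by rewrite sact1 mul0r addr0.
- have -> : (k.+1%:Z = k%:Z + 1)%R by lia.
  rewrite fpow_succ !sactM !sgen lmul_w /lmul eqxx; case: IHk => -> ->.
  by split; ring.
- have -> : (- k.+1%:Z = - k%:Z - 1)%R by lia.
  rewrite fpow_pred !sactM !sgenV lmulV_w.
  have -> q : lmulV c q (c :: w) = (q (c :: w) - lmulV c q w)%R.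
    by rewrite /lmulV /= eqxx.
  by rewrite lmulV_w; case: IHk => -> ->; split; ring.
Qed.

(** Normal forms in a free group: [k] alternating powers with nonzero exponents, the first one of
    generator [c]. *)
Inductive syllabic : nat -> bool -> G -> Prop :=
| syllabic1 c : syllabic 0 c 1
| syllabicM k c (e : int) g : e != 0%R -> syllabic k (~~ c) g ->
    syllabic k.+1 c (fpow c e * g).

Lemma syllabic_mul d (e : int) k c g : e != 0%R -> syllabic k c g ->
  exists k' c', syllabic k' c' (fpow d e * g).
Proof.
move=> e0; case=> {k c g} [c|k c e' g e'0 Sg].
  by exists 1%N, d; apply: syllabicM => //; exact: syllabic1.
have [->|dc] := eqVneq d c; last first.
  exists k.+2, d; apply: syllabicM => //.
  have -> : ~~ d = c by case: d c dc {Sg} => -[].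
  exact: syllabicM.
rewrite mulgA -fpowD; have [->|ee0] := eqVneq (e + e')%R 0%R.
  by exists k, (~~ c); rewrite mul1g.
by exists k.+1, c; apply: syllabicM.
Qed.

Lemma fib_syllabic g : fib g -> exists k c, syllabic k c g.
Proof.
pose S h := exists k c, syllabic k c h.
pose K := [set g : G | forall h, S h -> S (g * h) /\ S (g^-1 * h)].
suff FK : fib `<=` K.
  have S1 : S 1 by exists 0%N, false; exact: syllabic1.
  by move=> /FK/(_ 1 S1)[]; rewrite mulg1.
have Kgen c : K (fgen c).
  move=> h [k [d Sh]].
  have := syllabic_mul c (isT : 1%R != 0%R :> int) Sh.
  have := syllabic_mul c (isT : (-1)%R != 0%R :> int) Sh.
  by rewrite /= !expg1.
apply: fiber_ind; [|exact: (Kgen false)|exact: (Kgen true)].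
apply: subgroup_setP => [h Sh|x y Kx Ky h Sh|x Kx h Sh].
- by rewrite invg1 mul1g.
- rewrite invgM -!mulgA; split; first by apply: (Kx _ _).1; apply: (Ky _ _).1.
  by apply: (Ky _ _).2; apply: (Kx _ _).2.
- by rewrite invgK; have [] := Kx h Sh.
Qed.

Fixpoint alternating k c : seq bool :=
  if k is k'.+1 then c :: alternating k' (~~ c) else [::].

(** The coefficient at the alternating monomial is the product of the exponents. The vanishing at
    longer monomials removes the other summand given by [sact_fpow]. *)
Lemma syllabic_coef k c g : syllabic k c g ->
  sact g series1 (alternating k c) != 0%R /\
  forall j d, (k < j)%N -> sact g series1 (alternating j d) = 0%R.
Proof.
have altE c' j : (if alternating j (~~ c') is d :: _ then d != c' else true) = true.
  by case: j => //= j; case: c'.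
elim=> {k c g} [c|k c e g e0 _ [g0 gj]].
  by rewrite sact1; split=> // -[].
rewrite sactM; split.
  have [_ ->] := sact_fpow e (sact g series1) (altE c k).
  by rewrite (gj k.+1 c) // add0r mulf_neq0.
move=> [//|j] d; rewrite ltnS => kj; have [->|dc] := eqVneq d c.
  have [_ ->] := sact_fpow e (sact g series1) (altE c j).
  by rewrite (gj j.+1 c) 1?ltnW // (gj j) // mulr0.
have -> : d = ~~ c by case: d c dc {g0 altE} => -[].
have [-> _] := @sact_fpow c e (sact g series1) (alternating j.+1 (~~ c)) (altE c j.+1).
by rewrite gj // ltnW.
Qed.

Lemma sact_faithful g : fib g -> sact g series1 = series1 -> g = 1.
Proof.
move=> /fib_syllabic[k [c Sg]] g1; have [] := syllabic_coef Sg.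
by rewrite g1; case: Sg.
Qed.

Lemma iter_gamma_omega_eq1 g :
  (forall n, iter n (@gamma_omega G) [set: G] g) -> g = 1.
Proof.
move=> Gg.
have dg n : depth n.+1 g by apply: iter_gamma_omega_depth; apply: Gg.
apply: sact_faithful; first by have [] := dg 0%N.
apply/subr0_eq/vanish_eq0 => n; apply: vanishS.
by have [] := dg n.
Qed.

End SeriesAction.

(** * The lower bound and the conclusion *)

Local Open Scope group_scope.

Lemma fib_gamma_omega g h : fib g -> fib h -> gamma_omega [set: G] [~ g, h].
Proof.
by move=> Fg Fh n; apply: (fiber_comm_gamma one_relator_gen one_relator_rel).
Qed.

(** [comm_step] lies in [gamma setT m] for every [m], so by [comm_gamma] one commutator with it
    achieves [omega] commutations with [G]. *)
Lemma comm_seq_gamma_omega n : iter n.+1 (@gamma_omega G) [set: G] (comm_seq n).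
Proof.
have Fa : fib ga by exact: fiber_gen0.
have Fab : fib (ga ^ gb) by exact: fiber_gen1.
have sF := fib_subgroup.
have nG m : normal_set (iter m (@gamma_omega G) [set: G]).
  by elim: m => [|m IHm]; [exact: normal_setT|exact: gamma_omega_normal].
elim: n => [|n IHn]; first exact: fib_gamma_omega.
have step : gamma_omega [set: G] comm_step.
  apply: fib_gamma_omega; first exact: (subgroup_setM sF).
  exact (subgroup_setX 2 sF Fab).
rewrite iterS => m.
suff: gamma (iter n.+1 (@gamma_omega G) [set: G]) m.+1 (comm_seq n.+1).
  by apply: comm_subgroup_subl; exact: gamma_normal.
exact: comm_gamma.
Qed.

Theorem theorem1 : lcs_length one_relator_group (omul omega omega).
Proof.
apply: lcs_length_omega2 => [n|g]; last exact: iter_gamma_omega_eq1.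
by exists (comm_seq n); [exact: comm_seq_gamma_omega|exact: comm_seq_neq1].
Qed.
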